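(* Let (A1)–(A4) (written out in the context) hold, and let $\mathbf{S}^k$, $k=1,\ldots,N$, solve the finite-volume scheme $$\frac{\mathrm{m}(K)}{\Delta t}\Phi_K(S_{i,K}^k-S_{i,K}^{k-1})+\sum_{\sigma\in\mathcal{E}_K}F_{i,K,\sigma}(\mathbf{S}^k)=0,\quad K\in\mathcal{T},\ i=1,\ldots,n,$$ $$F_{i,K,\sigma}(\mathbf{S}^k)=-\tau_\sigma c_{i,\sigma}^k a_\sigma^k\,\mathrm{D}_{K,\sigma}\Big(P_c(S^k)+\frac{\beta(S^k)-\beta(S^{k-1})}{\Delta t}\Big)-\tau_\sigma\sum_{j=1}^n M_{ij}(\mathbf{S}_\sigma^k)\,\mathrm{D}_{K,\sigma}\mu_j^k ,$$ (all quantities being defined in the context). Then there exists a constant $C>0$ depending on $\mathbf{S}^0$ (and uniform in $\eta=\max\{\Delta x,\Delta t\}$) such that $$\sum_{K\in\mathcal{T}}\mathrm{m}(K)\bigg|\frac{\beta(S_K^k)-\beta(S_K^{k-1})}{\Delta t}\bigg|^2+\sum_{\sigma\in\mathcal{E}}\tau_\sigma a_\sigma^k\bigg|\mathrm{D}_{K,\sigma}\bigg(\frac{\beta(S_K^k)-\beta(S_K^{k-1})}{\Delta t}\bigg)\bigg|^2\le C.$$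
   Context: **Domain and data.** $\Omega\subset\mathbb{R}^d$ ($d\ge1$) is a bounded domain with $\partial\Omega=\Gamma_D\cup\Gamma_N$, $\Gamma_D\cap\Gamma_N=\emptyset$, $\Gamma_D$ of positive measure, $\Gamma_N$ open in $\partial\Omega$. $n$ is the number of components, $\mathcal{D}=\{\mathbf{S}\in\mathbb{R}^n: S_1,\ldots,S_n>0,\ \sum_{i=1}^n S_i<1\}$, and for $\mathbf{S}=(S_1,\ldots,S_n)$ we write $S=\sum_{i=1}^n S_i$. $S_1^D,\ldots,S_n^D$ are the given Dirichlet data, $S^D=\sum_i S_i^D$. **Assumptions.** (A1) The porosity $\Phi:\Omega\to[0,1]$ is integrable with $\Phi\ge c_\Phi>0$ in $\Omega$; the initial data satisfy $H(\mathbf{S}^0)=\int_\Omega(\Phi E(\mathbf{S}^0)+\frac12|\nabla\beta(S^0)|^2)dx<\infty$ and $S_i^0\ge c$, $S^0=\sum_i S_i^0\le1-c$ in $\Omega$ for some $c\in(0,1)$. (A2) $M=(M_{ij})\in C^0([0,1]^n;\mathbb{R}^{n\times n})$ is symmetric, positive semidefinite, and there are $0<c_M<C_M<\infty$ with $c_M|\Pi z|^2\le\sum_{i,j=1}^nM_{ij}(\mathbf{S})z_iz_j\le C_M|\Pi z|^2$ for all $z\in\mathbb{R}^n$, $\mathbf{S}\in\mathcal{D}$, where $\Pi=I-\frac1n\mathbf{1}\otimes\mathbf{1}$, $\mathbf{1}=(1,\ldots,1)$. (A3) For $S\in[0,1]$, $$a(S)=\frac{S^{\gamma_0}(1-S)^{\gamma_1}}{S^{\gamma_0}+(1-S)^{\gamma_1}},\quad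 b(S)=\beta'(S)=\frac{S^{\gamma_0}}{S^{\gamma_0}+(1-S)^{\gamma_1}}\Big(1+\frac{(1-S)^{\gamma_1}}{S^{\gamma_2}}\Big),$$ where $\gamma_0>\gamma_2$, $\gamma_1>2$, $\gamma_2>2$. (A4) $P_c$ is defined by $P_c'(S)=S^{-p_0}+(1-S)^{-p_1}$, where $p_0\le\gamma_2$, $p_1\le\gamma_1$. **Energy and chemical potentials.** $$\psi(S)=\int_{S^D}^S\frac{b(y)}{a(y)}dy,\quad \Psi(S)=\int_{S^D}^S\int_{S^D}^z\frac{b(y)}{a(y)}dy\,dz,$$ $$E(\mathbf{S})=\sum_{i=1}^n S_i\log\frac{S_i}{S_i^D}-S\log\frac{S}{S^D}+\Psi(S),\quad \mu_i=\frac{\partial E}{\partial S_i}=\log\frac{S_i}{S}-\log\frac{S_i^D}{S^D}+\psi(S).$$ **Mesh.** $(\mathcal{T},\mathcal{E},\mathcal{P})$ is an admissible mesh of $\Omega$ in the sense of Eymard, Gallouët and Herbin: $\mathcal{T}$ is a family of open polygonal convex cells $K\subset\Omega$, $\mathcal{E}$ the family of edges (faces), $\mathcal{P}=(x_K)_{K\in\mathcal{T}}$ a family of points associated to the cells, and the segment joining $x_K$ and $x_L$ of two neighboring cells is orthogonal to their common edge $\sigma=K|L$. $\mathcal{E}_K$ is the set of edges of $K$; $\mathcal{E}=\mathcal{E}_{\rm int}\cup\mathcal{E}_{\rm ext}$ (interior/boundary edges), $\mathcal{E}_{\rm ext}=\mathcal{E}_{\rm ext}^D\cup\mathcal{E}_{\rm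 ext}^N$ (edges on the Dirichlet, resp. Neumann boundary). $\mathrm{m}$ is Lebesgue measure ($d$- or $(d-1)$-dimensional). $\Delta x=\sup\{\mathrm{diam}(K):K\in\mathcal{T}\}$. $\mathrm{d}_\sigma=|x_K-x_L|$ if $\sigma=K|L$, $\mathrm{d}_\sigma=\mathrm{dist}(x_K,\sigma)$ if $\sigma\in\mathcal{E}_{\rm ext}$; $\tau_\sigma=\mathrm{m}(\sigma)/\mathrm{d}_\sigma$. The time step is $\Delta t=T/N$ with $T>0$, $N\in\mathbb{N}$. $\mathbf{S}^k$ belongs to the space $V_{\Delta x}^n$ of $\mathbb{R}^n$-valued functions constant on each cell, $v=(v_K)_{K\in\mathcal{T}}$. For a cell quantity $v$ and $\sigma\in\mathcal{E}_K$: $\mathrm{D}_{K,\sigma}v=v_{K,\sigma}-v_K$, where $v_{K,\sigma}=v_L$ if $\sigma=K|L$; $v_{K,\sigma}=v_\sigma^D=\mathrm{m}(\sigma)^{-1}\int_\sigma v\,ds$ (mean of the boundary value) if $\sigma\in\mathcal{E}_{\rm ext}^D$; and $v_{K,\sigma}=v_K$ if $\sigma\in\mathcal{E}_{\rm ext}^N$. In particular, on Dirichlet edges $S_{i,K,\sigma}=S_{i,\sigma}^D=\mathrm{m}(\sigma)^{-1}\int_\sigma S_i^D\,ds$, and the boundary value of $\mu_i$ is $0$. In sums over $\sigma\in\mathcal{E}$, $K$ is a cell with $\sigma\in\mathcal{E}_K$. **Scheme quantities.** The discrete initial datum is $S_{i,K}^0=\mathrm{m}(K)^{-1}\int_K S_i^0dx$.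 Further, $\Phi_K=\mathrm{m}(K)^{-1}\int_K\Phi\,dx$, $S_K^k=\sum_iS_{i,K}^k$, and $S_{i,K}^k=S_i(\boldsymbol{\mu}_K^k)$, where $\boldsymbol\mu\mapsto\mathbf{S}(\boldsymbol\mu)\in\mathcal{D}$ is the inverse of $\mathbf{S}\mapsto\boldsymbol\mu=(\mu_1,\ldots,\mu_n)$; $S_{i,\sigma}^k=\frac12(S_{i,K}^k+S_{i,K,\sigma}^k)$, $c_{i,K}^k=S_{i,K}^k/S_K^k$ (similarly $c_{i,K,\sigma}^k=S_{i,K,\sigma}^k/S_{K,\sigma}^k$), and $$a_\sigma^k=\frac{\beta(S_{K,\sigma}^k)-\beta(S_K^k)}{\psi(S_{K,\sigma}^k)-\psi(S_K^k)}$$ (understood as $a(S_K^k)$ if $S_{K,\sigma}^k=S_K^k$). With $\mathcal{N}_1=\{i:c_{i,K}^k\ne c_{i,K,\sigma}^k\}$, $\mathcal{N}_2=\{i:c_{i,K}^k=c_{i,K,\sigma}^k\}$ (depending on $\sigma,k$), put $c_{i,\sigma}^k=c_{i,K}^k$ for $i\in\mathcal{N}_2$ and, for $i\in\mathcal{N}_1$, $$c_{i,\sigma}^k=\frac1{m_\sigma^k}\frac{c_{i,K,\sigma}^k-c_{i,K}^k}{\log c_{i,K,\sigma}^k-\log c_{i,K}^k},\quad m_\sigma^k=\Big(1-\sum_{i\in\mathcal{N}_2}c_{i,K}^k\Big)^{-1}\sum_{i\in\mathcal{N}_1}\frac{c_{i,K,\sigma}^k-c_{i,K}^k}{\log c_{i,K,\sigma}^k-\log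 c_{i,K}^k}$$ ($m_\sigma^k$ is not needed if $\mathcal{N}_1=\emptyset$).
   Formalization: The constant C is a nondecreasing function of the discrete energy of the initial datum (uniformity over all meshes fails, e.g. if S^0 differs from S^D on Γ_D), and the Dirichlet data S_i^D are constants, as needed for ψ, E and S(μ) to be defined. *)

(* Defs.v *)
From HB Require Import structures.
From mathcomp Require Import all_boot all_order all_algebra.
From mathcomp Require Import all_classical all_reals all_analysis.

Set Implicit Arguments.
Unset Strict Implicit.
Unset Printing Implicit Defensive.
Import Order.TTheory GRing.Theory Num.Theory.
Import numFieldNormedType.Exports.

Local Open Scope classical_set_scope.
Local Open Scope ring_scope.

(* Points of R^d are row vectors. The library norm on 'rV[R]_d is the sup
   norm: it induces the Euclidean topology, but lengths need [enorm]. *)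

Definition dotp (R : realType) (d : nat) (x y : 'rV[R]_d) : R :=
  \sum_(i < d) x ord0 i * y ord0 i.

Definition enorm (R : realType) (d : nat) (x : 'rV[R]_d) : R :=
  Num.sqrt (dotp x x).

(* Lebesgue measure on R^d is the d-fold product of the one-dimensional one.
   It is built on d-tuples, which carry the product (that is, Borel)
   sigma-algebra; [pt] turns a tuple into a point. *)

Definition consp (R : realType) (d : nat)
    (p : measurableTypeR R * d.-tuple (measurableTypeR R)) :
    d.+1.-tuple (measurableTypeR R) :=
  [tuple of p.1 :: p.2].

Lemma measurable_consp (R : realType) (d : nat) :
  measurable_fun setT (@consp R d).
Proof. by apply: measurable_cons => //=. Qed.

Lemma product_sigma_finite d1 d2 (T1 : measurableType d1)
    (T2 : measurableType d2) (R : realType)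
    (m1 : {sigma_finite_measure set T1 -> \bar R})
    (m2 : {sigma_finite_measure set T2 -> \bar R}) :
  sigma_finite setT (m1 \x m2)%E.
Proof.
have /sigma_finiteP[F [TF ndF Foo]] := sigma_finiteT m1.
have /sigma_finiteP[G [TG ndG Goo]] := sigma_finiteT m2.
exists (fun k => F k `*` G k).
  rewrite -setXTT TF TG predeqE => -[x y]; split.
    move=> [/= [k _ Fkx] [l _ Gly]]; exists (maxn k l) => //; split.
    - by move: x Fkx; exact/subsetPset/ndF/leq_maxl.
    - by move: y Gly; exact/subsetPset/ndG/leq_maxr.
  by move=> [k _ []/= ? ?]; split; exists k.
move=> k; have [? ?] := Foo k; have [? ?] := Goo k.
split; first exact: measurableX.
by rewrite product_measure1E// lte_mul_pinfty// ge0_fin_numE.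
Qed.

Definition lebesgue_tuple_step (R : realType) (d : nat)
    (mu : {sigma_finite_measure set (d.-tuple (measurableTypeR R)) -> \bar R}) :
    set (d.+1.-tuple (measurableTypeR R)) -> \bar R :=
  pushforward (lebesgue_measure \x mu)%E (@consp R d).

Section lebesgue_tuple_step.
Context (R : realType) (d : nat).
Context (mu : {sigma_finite_measure
                 set (d.-tuple (measurableTypeR R)) -> \bar R}).

HB.instance Definition _ := Measure.copy (lebesgue_tuple_step mu)
  (measure_function_pushforward__canonical__measure_function_Measure
     (lebesgue_measure \x mu)%E (@measurable_consp R d)).

Lemma sigma_finite_lebesgue_tuple_step :
  sigma_finite setT (lebesgue_tuple_step mu).
Proof.
have [F TF Foo] := product_sigma_finite lebesgue_measure mu.
pose uncons (t : d.+1.-tuple (measurableTypeR R)) :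
    measurableTypeR R * d.-tuple (measurableTypeR R) :=
  (thead t, [tuple of behead t]).
have unconsK t : consp (uncons t) = t.
  by apply/val_inj; rewrite /= [in RHS](tuple_eta t).
have conspK p : uncons (consp p) = p.
  by case: p => x t; congr pair; exact/val_inj.
have muncons : measurable_fun setT uncons.
  apply/measurable_fun_pairP; split; first exact: measurable_tnth.
  exact: measurable_behead.
exists (fun k => uncons @^-1` F k).
  by rewrite -preimage_bigcup -TF preimage_setT.
move=> k; have [mF Fk] := Foo k; split.
  by rewrite -[X in measurable X]setTI; exact: muncons.
rewrite /lebesgue_tuple_step /pushforward -comp_preimage.
by rewrite (_ : uncons \o _ = id) ?preimage_id//; apply/funext => p /=.
Qed.

HB.instance Definition _ := Measure_isSigmaFinite.Build _ _ _
  (lebesgue_tuple_step mu) sigma_finite_lebesgue_tuple_step.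

End lebesgue_tuple_step.

Section lebesgue_tuple0.
Context (R : realType).

Definition lebesgue_tuple0 : set (0.-tuple (measurableTypeR R)) -> \bar R :=
  dirac [tuple].

HB.instance Definition _ := Measure.on lebesgue_tuple0.

Lemma sigma_finite_lebesgue_tuple0 : sigma_finite setT lebesgue_tuple0.
Proof.
apply: fin_num_fun_sigma_finite; first by rewrite measure0.
by move=> A mA; rewrite /lebesgue_tuple0 /dirac.
Qed.

HB.instance Definition _ := Measure_isSigmaFinite.Build _ _ _
  lebesgue_tuple0 sigma_finite_lebesgue_tuple0.

End lebesgue_tuple0.

Fixpoint leb (R : realType) (d : nat) :
    {sigma_finite_measure set (d.-tuple (measurableTypeR R)) -> \bar R} :=
  match d with
  | 0 => @lebesgue_tuple0 R
  | d'.+1 => lebesgue_tuple_step (leb R d')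
  end.

Definition pt (R : realType) (d : nat) (t : d.-tuple (measurableTypeR R)) :
    'rV[R]_d :=
  \row_(i < d) tnth t i.

Definition volume (R : realType) (d : nat) (A : set 'rV[R]_d) : \bar R :=
  leb R d (@pt R d @^-1` A).

Definition vintegral (R : realType) (d : nat) (A : set 'rV[R]_d)
    (f : 'rV[R]_d -> R) : \bar R :=
  (\int[leb R d]_(t in @pt R d @^-1` A) (f (pt t))%:E)%E.

Definition vmeasurable (R : realType) (d : nat) (A : set 'rV[R]_d)
    (f : 'rV[R]_d -> R) : Prop :=
  measurable_fun (@pt R d @^-1` A)
    (fun t : d.-tuple (measurableTypeR R) => f (pt t) : measurableTypeR R).

Definition vintegrable (R : realType) (d : nat) (A : set 'rV[R]_d)
    (f : 'rV[R]_d -> R) : Prop :=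
  (leb R d).-integrable (@pt R d @^-1` A) (fun t => (f (pt t))%:E).

Definition cell_mean (R : realType) (d : nat) (K : set 'rV[R]_d)
    (f : 'rV[R]_d -> R) : R :=
  (fine (volume K))^-1 * fine (vintegral K f).

Definition diam (R : realType) (d : nat) (A : set 'rV[R]_d) : \bar R :=
  ereal_sup [set (enorm (x - y))%:E | x in A & y in A].

(* k-dimensional Hausdorff measure, normalized by the volume of the unit ball
   of R^k so that it is the usual k-dimensional area. For k = 0 it is the
   counting measure, whence the separate value for the empty set. *)

Definition unit_ball_volume (R : realType) (k : nat) : R :=
  fine (volume [set x : 'rV[R]_k | enorm x <= 1]).

Definition hausdorff_gauge (R : realType) (d k : nat) (A : set 'rV[R]_d) :
    \bar R :=
  if `[< A = set0 >] then 0%E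
  else (unit_ball_volume R k * (fine (diam A) / 2) ^+ k)%:E.

Definition hausdorff_pre (R : realType) (d k : nat) (delta : R)
    (A : set 'rV[R]_d) : \bar R :=
  ereal_inf [set (\sum_(0 <= i <oo) hausdorff_gauge k (U i))%E
            | U in [set U : nat -> set 'rV[R]_d |
                     (forall i, (diam (U i) <= delta%:E)%E) /\
                     A `<=` \bigcup_i U i]].

Definition hausdorff (R : realType) (d k : nat) (A : set 'rV[R]_d) : \bar R :=
  ereal_sup [set hausdorff_pre k delta A | delta in [set x : R | 0 < x]].

Definition boundary (R : realType) (d : nat) (A : set 'rV[R]_d) :
    set 'rV[R]_d :=
  closure A `\` interior A.

Definition partial (R : realType) (d : nat) (j : 'I_d) (f : 'rV[R]_d -> R) :
    'rV[R]_d -> R :=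
  fun x => 'D_(delta_mx ord0 j) f x.

Definition iter_partial (R : realType) (d : nat) (s : seq 'I_d)
    (f : 'rV[R]_d -> R) : 'rV[R]_d -> R :=
  foldr (@partial R d) f s.

Definition smooth (R : realType) (d : nat) (f : 'rV[R]_d -> R) : Prop :=
  forall s : seq 'I_d, continuous (iter_partial s f) /\
    forall (j : 'I_d) (x : 'rV[R]_d),
      derivable (iter_partial s f) x (delta_mx ord0 j).

Definition test_function (R : realType) (d : nat) (Omega : set 'rV[R]_d)
    (f : 'rV[R]_d -> R) : Prop :=
  smooth f /\
  exists2 K : set 'rV[R]_d, compact K /\ K `<=` Omega &
    forall x, ~ K x -> f x = 0.

Definition locally_integrable (R : realType) (d : nat) (Omega : set 'rV[R]_d)
    (f : 'rV[R]_d -> R) : Prop :=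
  vmeasurable Omega f /\
  forall K : set 'rV[R]_d, compact K -> K `<=` Omega -> vintegrable K f.

Definition weak_gradient (R : realType) (d : nat) (Omega : set 'rV[R]_d)
    (f : 'rV[R]_d -> R) (g : 'I_d -> 'rV[R]_d -> R) : Prop :=
  [/\ locally_integrable Omega f,
      forall j, locally_integrable Omega (g j) &
      forall (phi : 'rV[R]_d -> R) (j : 'I_d), test_function Omega phi ->
        vintegral Omega (fun x => f x * partial j phi x) =
        (- vintegral Omega (fun x => g j x * phi x)%R)%E].

Definition saturation_set (R : realType) (n : nat) : set 'rV[R]_n :=
  [set S | (forall i, 0 < S ord0 i) /\ \sum_(i < n) S ord0 i < 1].

Definition tot_sat (R : realType) (n : nat) (S : 'rV[R]_n) : R :=
  \sum_(i < n) S ord0 i.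

(* The Dirichlet data [SD] are constants: the energy E, the map S |-> mu and
   its inverse refer to one and the same vector SD at every point and in every
   cell. Hence SD is also its own mean value on each boundary face, and mu
   vanishes there. *)
Record problem (R : realType) (d n : nat) := Problem {
  Omega : set 'rV[R]_d;
  GammaD : set 'rV[R]_d;
  GammaN : set 'rV[R]_d;
  Tend : R;
  Phi : 'rV[R]_d -> R;
  S0 : 'rV[R]_d -> 'rV[R]_n;
  SD : 'rV[R]_n;
  coef_M : 'rV[R]_n -> 'M[R]_n;
  gamma0 : R;
  gamma1 : R;
  gamma2 : R;
  p0 : R;
  p1 : R;
  beta : R -> R;
  Pc : R -> R
}.

Definition oriented_integral (R : realType) (s t : R) (f : R -> R) : R :=
  if s <= t then (\int[lebesgue_measure]_(y in `[s, t]) f y)%R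
  else - (\int[lebesgue_measure]_(y in `[t, s]) f y)%R.

Definition coef_a (R : realType) (d n : nat) (P : problem R d n) (s : R) : R :=
  (s `^ gamma0 P * (1 - s) `^ gamma1 P) /
  (s `^ gamma0 P + (1 - s) `^ gamma1 P).

Definition coef_b (R : realType) (d n : nat) (P : problem R d n) (s : R) : R :=
  s `^ gamma0 P / (s `^ gamma0 P + (1 - s) `^ gamma1 P) *
  (1 + (1 - s) `^ gamma1 P / s `^ gamma2 P).

Definition psi (R : realType) (d n : nat) (P : problem R d n) (s : R) : R :=
  oriented_integral (tot_sat (SD P)) s (fun y => coef_b P y / coef_a P y).

Definition Psi (R : realType) (d n : nat) (P : problem R d n) (s : R) : R :=
  oriented_integral (tot_sat (SD P)) s
    (fun z => oriented_integral (tot_sat (SD P)) z (fun y => coef_b P y / coef_a P y)).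

Definition energy_density (R : realType) (d n : nat) (P : problem R d n)
    (S : 'rV[R]_n) : R :=
  \sum_(i < n) S ord0 i * ln (S ord0 i / SD P ord0 i)
  - tot_sat S * ln (tot_sat S / tot_sat (SD P)) + Psi P (tot_sat S).

Definition chem_potential (R : realType) (d n : nat) (P : problem R d n)
    (S : 'rV[R]_n) : 'rV[R]_n :=
  \row_(i < n) (ln (S ord0 i / tot_sat S) - ln (SD P ord0 i / tot_sat (SD P))
                + psi P (tot_sat S)).

(* S = S(mu), the inverse of the map S |-> mu on [saturation_set]. *)
Definition is_saturation_of (R : realType) (d n : nat) (P : problem R d n)
    (mu S : 'rV[R]_n) : Prop :=
  saturation_set S /\ chem_potential P S = mu.

Definition domain_ok (R : realType) (d n : nat) (P : problem R d n) : Prop :=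
  [/\ [/\ open (Omega P), connected (Omega P), Omega P !=set0 &
          exists r : R, forall x, Omega P x -> enorm x <= r],
      boundary (Omega P) = GammaD P `|` GammaN P,
      GammaD P `&` GammaN P = set0,
      (0 < hausdorff d.-1 (GammaD P))%E &
      exists2 U : set 'rV[R]_d, open U & GammaN P = boundary (Omega P) `&` U].

(* Finiteness of H(S0) includes the existence of the weak gradient of
   beta(S0). *)
Definition assumption_A1 (R : realType) (d n : nat) (P : problem R d n) :
    Prop :=
  [/\ vintegrable (Omega P) (Phi P) /\
      (forall x, Omega P x -> 0 <= Phi P x <= 1),
      (exists2 cPhi : R, 0 < cPhi & forall x, Omega P x -> cPhi <= Phi P x),
      (forall i, vmeasurable (Omega P) (fun x => S0 P x ord0 i)),
      (exists2 grad : 'I_d -> 'rV[R]_d -> R,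
         weak_gradient (Omega P) (fun x => beta P (tot_sat (S0 P x))) grad &
         (vintegral (Omega P)
            (fun x => (Phi P x * energy_density P (S0 P x)
                       + 2^-1 * \sum_(j < d) grad j x ^+ 2)%R) < +oo)%E) &
      (exists2 c : R, 0 < c < 1 & forall x, Omega P x ->
         (forall i, c <= S0 P x ord0 i) /\ tot_sat (S0 P x) <= 1 - c)].

Definition quad (R : realType) (n : nat) (A : 'M[R]_n) (z : 'rV[R]_n) : R :=
  \sum_(i < n) \sum_(j < n) A i j * z ord0 i * z ord0 j.

Definition proj_mean0 (R : realType) (n : nat) (z : 'rV[R]_n) : 'rV[R]_n :=
  z *m (1%:M - n%:R^-1 *: const_mx 1).

Definition assumption_A2 (R : realType) (d n : nat) (P : problem R d n) :
    Prop :=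
  let cube := [set S : 'rV[R]_n | forall i, 0 <= S ord0 i <= 1] in
  [/\ {within cube, continuous (coef_M P)},
      (forall S, cube S -> (coef_M P S)^T = coef_M P S),
      (forall S z, cube S -> 0 <= quad (coef_M P S) z) &
      exists c C : R, [/\ 0 < c, c < C &
        forall S z, saturation_set S ->
          c * enorm (proj_mean0 z) ^+ 2 <= quad (coef_M P S) z
          <= C * enorm (proj_mean0 z) ^+ 2]].

Definition assumption_A3 (R : realType) (d n : nat) (P : problem R d n) :
    Prop :=
  [/\ gamma2 P < gamma0 P, 2 < gamma1 P, 2 < gamma2 P,
      {within `[0, 1], continuous (beta P)} &
      forall s : R, 0 < s < 1 -> is_derive s 1 (beta P) (coef_b P s)].

Definition assumption_A4 (R : realType) (d n : nat) (P : problem R d n) :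
    Prop :=
  [/\ p0 P <= gamma2 P, p1 P <= gamma1 P &
      forall s : R, 0 < s < 1 ->
        is_derive s 1 (Pc P) (s `^ (- p0 P) + (1 - s) `^ (- p1 P))].

(* [face_cell s] is the cell K attached to s in sums over all faces; which of
   the adjacent cells it is, is left arbitrary. *)
Record mesh (R : realType) (d : nat) := Mesh {
  cell : finType;
  face : finType;
  cell_set : cell -> set 'rV[R]_d;
  face_set : face -> set 'rV[R]_d;
  center : cell -> 'rV[R]_d;
  faces : cell -> {set face};
  face_cell : face -> cell
}.
Arguments cell_set {R d} m _.
Arguments face_set {R d} m _.
Arguments center {R d} m _.
Arguments faces {R d} m _.
Arguments face_cell {R d} m _.

Definition open_polytope (R : realType) (d : nat) (K : set 'rV[R]_d) : Prop :=
  K !=set0 /\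
  exists hs : seq ('rV[R]_d * R),
    K = [set x | forall h, h \in hs -> dotp h.1 x < h.2].

Definition in_hyperplane (R : realType) (d : nat) (A : set 'rV[R]_d) : Prop :=
  exists (nu : 'rV[R]_d) (r : R), nu <> 0 /\ forall x, A x -> dotp nu x = r.

(* Admissible meshes in the sense of Eymard, Gallouet and Herbin. Every face s
   is either interior, s = K|L, and then belongs to K and L only, or it belongs
   to a single cell and lies on the Dirichlet or on the Neumann boundary. The
   last clause says that the line through x_K orthogonal to a boundary face s
   of K meets s, unless x_K lies on s. *)
Definition admissible (R : realType) (d n : nat) (P : problem R d n)
    (m : mesh R d) : Prop :=
  let cs := cell_set m in
  let fs := face_set m in
  [/\ (forall K, open_polytope (cs K) /\ cs K `<=` Omega P) /\
      closure (Omega P) = \bigcup_(K in [set: cell m]) closure (cs K),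
      [/\ forall s, fs s `<=` closure (Omega P) /\ in_hyperplane (fs s),
          forall s, (0 < hausdorff d.-1 (fs s))%E,
          forall s s', s != s' -> hausdorff d.-1 (fs s `&` fs s') = 0%E,
          forall K, boundary (cs K) =
            \bigcup_(s in [set s | s \in faces m K]) closure (fs s) &
          forall s, s \in faces m (face_cell m s)],
      (forall K L, K != L ->
         hausdorff d.-1 (closure (cs K) `&` closure (cs L)) = 0%E \/
         exists s, [/\ s \in faces m K, s \in faces m L &
                       closure (cs K) `&` closure (cs L) = closure (fs s)]) /\
      (forall s,
         (exists K L, [/\ K != L,
             closure (cs K) `&` closure (cs L) = closure (fs s) &
             forall J, (s \in faces m J) = (J == K) || (J == L)]) \/
         (exists2 K, forall J, (s \in faces m J) = (J == K) &
             fs s `<=` GammaD P \/ fs s `<=` GammaN P)) &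
      [/\ forall K, closure (cs K) (center m K),
          forall K L s, K != L -> s \in faces m K -> s \in faces m L ->
            center m K <> center m L /\
            forall x y, fs s x -> fs s y ->
              dotp (center m K - center m L) (x - y) = 0 &
          forall K s, s \in faces m K -> fs s `<=` boundary (Omega P) ->
            ~ fs s (center m K) ->
            exists2 y, fs s y & forall z, fs s z ->
              dotp (y - center m K) (z - y) = 0]].

Definition neighbor (R : realType) (d : nat) (m : mesh R d) (K : cell m)
    (s : face m) : option (cell m) :=
  [pick L | (L != K) && (s \in faces m L)].

(* v_{K,s}, given the boundary value [vD] of v *)
Definition face_value (R : realType) (d n : nat) (P : problem R d n) (m : mesh R d)
    (V : Type) (vD : V) (v : cell m -> V) (K : cell m) (s : face m) : V :=
  match neighbor K s with
  | Some L => v L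
  | None => if `[< face_set m s `<=` GammaD P >] then vD else v K
  end.

Definition face_jump (R : realType) (d n : nat) (P : problem R d n) (m : mesh R d)
    (vD : R) (v : cell m -> R) (K : cell m) (s : face m) : R :=
  face_value P vD v K s - v K.

Definition cell_measure (R : realType) (d : nat) (m : mesh R d) (K : cell m) :
    R :=
  fine (volume (cell_set m K)).

Definition face_distance (R : realType) (d : nat) (m : mesh R d) (s : face m) :
    R :=
  let K := face_cell m s in
  match neighbor K s with
  | Some L => enorm (center m K - center m L)
  | None => inf [set enorm (center m K - y) | y in face_set m s]
  end.

(* Total division gives transmissibility 0 when a boundary face contains
   x_K, which is the usual convention. *)
Definition transmissibility (R : realType) (d : nat) (m : mesh R d)
    (s : face m) : R :=
  fine (hausdorff d.-1 (face_set m s)) / face_distance s.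

Definition composition (R : realType) (n : nat) (S : 'rV[R]_n) (i : 'I_n) : R :=
  S ord0 i / tot_sat S.

Definition log_mean (R : realType) (x y : R) : R := (y - x) / (ln y - ln x).

(* c_{i,s}, with cK = c_K and cL = c_{K,s} *)
Definition face_fraction (R : realType) (n : nat) (cK cL : 'I_n -> R)
    (i : 'I_n) : R :=
  let ms := (1 - \sum_(j < n | cK j == cL j) cK j)^-1 *
            \sum_(j < n | cK j != cL j) log_mean (cK j) (cL j) in
  if cK i == cL i then cK i else ms^-1 * log_mean (cK i) (cL i).

(* a_s, with sK = S_K and sL = S_{K,s} *)
Definition face_mobility (R : realType) (d n : nat) (P : problem R d n)
    (sK sL : R) : R :=
  if sL == sK then coef_a P sK
  else (beta P sL - beta P sK) / (psi P sL - psi P sK).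

Definition beta_rate (R : realType) (d n : nat) (P : problem R d n) (dt : R)
    (S S' : 'rV[R]_n) : R :=
  (beta P (tot_sat S) - beta P (tot_sat S')) / dt.

(* In the fluxes, [S] is the new and [S'] the old discrete saturation. *)
Definition flux (R : realType) (d n : nat) (P : problem R d n) (m : mesh R d)
    (dt : R) (S S' mu : cell m -> 'rV[R]_n) (i : 'I_n) (K : cell m)
    (s : face m) : R :=
  let SKs := face_value P (SD P) S K s in
  - transmissibility s
    * face_fraction (composition (S K)) (composition SKs) i
    * face_mobility P (tot_sat (S K)) (tot_sat SKs)
    * face_jump P (Pc P (tot_sat (SD P)) + beta_rate P dt (SD P) (SD P))
        (fun L => Pc P (tot_sat (S L)) + beta_rate P dt (S L) (S' L)) K s
  - transmissibility s
    * \sum_(j < n) coef_M P (2^-1 *: (S K + SKs)) i j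
                   * face_jump P 0 (fun L => mu L ord0 j) K s.

Definition scheme_solution (R : realType) (d n : nat) (P : problem R d n)
    (m : mesh R d) (N : nat) (mu S : nat -> cell m -> 'rV[R]_n) : Prop :=
  let dt := Tend P / N%:R in
  [/\ (forall K, S 0%N K =
         \row_(i < n) cell_mean (cell_set m K) (fun x => S0 P x ord0 i)),
      (forall k K, (0 < k <= N)%N -> is_saturation_of P (mu k K) (S k K)) &
      (forall k K i, (0 < k <= N)%N ->
         cell_measure K / dt * cell_mean (cell_set m K) (Phi P)
           * (S k K ord0 i - S k.-1 K ord0 i)
         + \sum_(s in faces m K) flux P dt (S k) (S k.-1) (mu k) i K s = 0)].

(* Discrete counterpart of H: the Dirichlet seminorm of beta(S) includes the
   jumps to the boundary value beta(S^D) across Dirichlet faces. *)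
Definition discrete_energy (R : realType) (d n : nat) (P : problem R d n)
    (m : mesh R d) (S : cell m -> 'rV[R]_n) : R :=
  \sum_(K : cell m)
     cell_measure K * (cell_mean (cell_set m K) (Phi P)
                       * energy_density P (S K))
  + 2^-1 * \sum_(s : face m) transmissibility s *
      `|face_jump P (beta P (tot_sat (SD P))) (fun L => beta P (tot_sat (S L)))
          (face_cell m s) s| ^+ 2.

(* Main.v *)
Require Import Defs.
From mathcomp Require Import all_boot all_order all_algebra.
From mathcomp Require Import all_classical all_reals all_analysis.
From mathcomp Require Import measurable_realfun.
From mathcomp Require Import ring lra.

Import Order.TTheory GRing.Theory Num.Theory.
Import numFieldNormedType.Exports.
Local Open Scope ring_scope.

(** Summed over the components, the scheme only sees the total saturation
[x]: the weights c_{i,s} on a face add up to 1 ([sum_face_fraction]), and the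
columns of M add up to 0, because [assumption_A2] puts the vector (1,...,1)
into its kernel ([quad_colsum0]). With
  v = P_c(x) + (beta(x) - beta(x')) / dt,   v = P_c(S^D) on Gamma_D,
where [x'] is the previous iterate, there remains ([scalar_step])
  m(K) Phi_K (x_K - x'_K) = dt sum_s tau_s a_s D_{K,s} v.

The estimate is asked at every single time step, although a degenerates at 0
and at 1 and the energy does not control a |D P_c|^2 there. What saves it is a
discrete maximum principle ([comparison_principle]). If K maximizes v, the right
side is at most 0, so x_K <= x'_K, so the rate in v_K is at most 0 and
v_K <= P_c(x_K) <= P_c(max x'). Thus v <= P_c(max(x', S^D)) in all cells; a cell
L with x_L above that maximum would have a positive rate and hence a v_L
above the bound. The same holds from below. Every iterate therefore stays in an
interval [e, 1 - e] that depends only on the data, and there b = beta' lies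
between positive constants, P_c' is bounded, and psi' = b / a >= 1.

Two discrete integrations by parts ([summation_by_parts]) then suffice. Testing
with psi(x), where a_s D psi = D beta exactly and Psi is convex, shows that
  sum m Phi Psi(x) + 1/2 sum tau |D beta(x)|^2
does not increase in time ([scalar_energy_decreases]). At time 0 it is at most
the discrete energy, since the mixing entropy is nonnegative ([entropy_ge0]).
Testing with the rate w = (beta(x) - beta(x')) / dt gives, by Young's
inequality,
  (max b)^-1 sum m Phi w^2 + 1/2 sum tau a |D w|^2
    <= 1/2 sum tau a |D P_c(x)|^2,
and on [e, 1 - e] one has a_s |D P_c|^2 <= const |D beta|^2
([mobility_pressure]), which the energy bounds at each step
([rate_estimate]). *)

Set Implicit Arguments.
Unset Strict Implicit.
Unset Printing Implicit Defensive.

(** * Increments and primitives on an interval *)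

Lemma increment_bounds (R : realType) (F dF : R -> R) (l u s t : R) :
  s <= t -> (forall x : R, s <= x <= t -> is_derive x 1 F (dF x)) ->
  (forall x : R, s <= x <= t -> l <= dF x <= u) ->
  l * (t - s) <= F t - F s <= u * (t - s).
Proof.
move=> st dFE bF.
have Fc : {within `[s, t], continuous F}%classic.
  apply: derivable_within_continuous => x; rewrite in_itv/= => xst.
  by have := dFE _ xst; move=> [].
have [|c cst ->] := @MVT_segment R F dF s t st _ Fc.
  by move=> x; rewrite in_itv/= => /andP[? ?]; apply: dFE; rewrite !ltW.
have /andP[lc cu] := bF c cst.
by apply/andP; split; apply: ler_wpM2r; rewrite ?subr_ge0.
Qed.

Lemma derive_gt0_lt (R : realType) (F dF : R -> R) (s t : R) :
  s < t -> (forall x : R, s <= x <= t -> is_derive x 1 F (dF x)) ->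
  (forall x : R, s <= x <= t -> 0 < dF x) -> F s < F t.
Proof.
move=> st dFE bF.
have Fc : {within `[s, t], continuous F}%classic.
  apply: derivable_within_continuous => x; rewrite in_itv/= => xst.
  by have := dFE _ xst; move=> [].
have [|c cst FE] := @MVT R F dF s t st _ Fc.
  by move=> x; rewrite in_itv/= => /andP[? ?]; apply: dFE; rewrite !ltW.
rewrite -subr_gt0 FE mulr_gt0 ?subr_gt0// bF//.
by move: cst; rewrite in_itv/= => /andP[? ?]; rewrite !ltW.
Qed.

Lemma lebesgue_itv_lty (R : realType) (s t : R) :
  (lebesgue_measure (`[s, t]%classic : set R) < +oo)%E.
Proof.
by rewrite lebesgue_measure_itv/=; case: ifP => // _; rewrite -EFinD ltry.
Qed.

Section oriented.
Context (R : realType) (lo hi : R) (f : R -> R).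
Hypothesis mf : measurable_fun `[lo, hi]%classic f.
Hypothesis bf : exists B : R, forall x : R, lo <= x <= hi -> `|f x| <= B.

Let intf (s t : R) : lo <= s -> t <= hi ->
  (@lebesgue_measure R).-integrable `[s, t]%classic (EFin \o f).
Proof.
move=> ls th.
have sub : (`[s, t] `<=` `[lo, hi])%classic.
  by move=> x /=; rewrite !in_itv/= => /andP[sx xt]; apply/andP; split; lra.
apply: measurable_bounded_integrable => //.
- exact: lebesgue_itv_lty.
- exact: measurable_funS mf.
- have [B fB] := bf; exists B; split; first exact: num_real.
  move=> M BM x xst; apply: (le_trans _ (ltW BM)); apply: fB.
  by have := sub _ xst; rewrite /= in_itv.
Qed.

(** Chasles' relation, for every position of the base point [s0]. *)
Lemma primitive_increment (s0 s t : R) :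
  lo <= s0 <= hi -> lo <= s -> s <= t -> t <= hi ->
  oriented_integral s0 t f - oriented_integral s0 s f =
    (\int[lebesgue_measure]_(y in `[s, t]) f y)%R.
Proof.
move=> /andP[l0 h0] ls st th.
have chasles (a b c : R) : lo <= a -> a <= b -> b <= c -> c <= hi ->
    (\int[lebesgue_measure]_(y in `[a, c]) f y =
     \int[lebesgue_measure]_(y in `[a, b]) f y
     + \int[lebesgue_measure]_(y in `[b, c]) f y)%R.
  move=> la ab bc ch.
  have := @Rintegral_itvB R f (BLeft a) (BRight c) b (intf la ch).
  rewrite !bnd_simp => /(_ ab bc) H.
  rewrite -(@Rintegral_itv_obnd_cbnd _ b) -?H; first by rewrite addrC subrK.
  apply: (integrableS _ _ _ (intf (le_trans la ab) ch)) => //.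
  by apply: subset_itvr; rewrite bnd_simp.
rewrite /oriented_integral; case: (leP s0 s) => s0s.
  by rewrite (le_trans s0s st) (chasles s0 s t)// addrC addKr.
case: (leP s0 t) => s0t; first by rewrite opprK addrC -chasles// ltW.
by rewrite (chasles s t s0)// ?ltW// opprK addrC addrK.
Qed.

Lemma primitive_increment_bounds (s0 s t m M : R) :
  lo <= s0 <= hi -> lo <= s -> s <= t -> t <= hi ->
  (forall x : R, s <= x <= t -> m <= f x <= M) ->
  m * (t - s) <= oriented_integral s0 t f - oriented_integral s0 s f
    <= M * (t - s).
Proof.
move=> s0P ls st th fP.
rewrite primitive_increment//.
have len : fine (lebesgue_measure (`[s, t]%classic : set R)) = t - s.
  rewrite lebesgue_measure_itv/= lte_fin; case: ltP => // ts.
  by rewrite (_ : t = s) ?subrr//; apply/le_anti; rewrite st ts.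
have cst r : (@lebesgue_measure R).-integrable `[s, t]%classic (EFin \o cst r).
  apply: measurable_bounded_integrable => //.
  - exact: lebesgue_itv_lty.
  - by exists `|r|; split => // x rx y _; exact: ltW.
rewrite -len -!(@Rintegral_cst _ _ _ (@lebesgue_measure R))//.
by apply/andP; split; apply: le_Rintegral => //;
  [exact: cst|exact: intf|move=> x; rewrite /= in_itv => /fP/andP[]
  |exact: intf|exact: cst|move=> x; rewrite /= in_itv => /fP/andP[]].
Qed.
End oriented.

(** * Volumes of cells and cell means *)

Local Open Scope classical_set_scope.

Definition tuple_cube (R : realType) (d : nat) (q : 'I_d -> R) (e : R) :
    set (d.-tuple (measurableTypeR R)) :=
  [set t | forall i, `|pt t ord0 i - q i| < e].

Lemma measurable_tuple_cube (R : realType) (d : nat) (q : 'I_d -> R) (e : R) :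
  measurable (tuple_cube q e).
Proof.
have -> : tuple_cube q e =
    \bigcap_(i in [set: 'I_d]) ((@tnth d R ^~ i) @^-1` `]q i - e, q i + e[).
  rewrite /tuple_cube; apply/seteqP; split => t /= qt i.
    by move=> _ /=; have := qt i; rewrite mxE in_itv/= ltr_distl.
  by have := qt i I; rewrite /= mxE in_itv/= ltr_distl.
apply: fin_bigcap_measurable => // i _.
rewrite -[X in measurable X]setTI.
exact: (@measurable_tnth _ (measurableTypeR R) d i).
Qed.

(** The sigma-algebra on tuples is the product one; an open set is the union of
the countably many cubes with rational center and radius 1/(k+1) that it
contains. *)
Lemma measurable_open (R : realType) (d : nat) (U : set 'rV[R]_d) :
  open U -> measurable (@pt R d @^-1` U).
Proof.
move=> oU.
pose F (p : 'rV[rat]_d * nat) : set (d.-tuple (measurableTypeR R)) :=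
  let B := tuple_cube (fun i => ratr (p.1 ord0 i) : R) p.2.+1%:R^-1 in
  if `[< B `<=` @pt R d @^-1` U >] then B else set0.
have -> : @pt R d @^-1` U = \bigcup_p F p.
  apply/seteqP; split => [t Ut|t [p _]]; last first.
    by rewrite /F; case: asboolP => // BU /BU.
  have /nbhs_ballP[e /= e0 eU] : nbhs (pt t) U by exact: open_nbhs_nbhs.
  (* the cube of radius 1/(k+1) around a rational point that near t has points
     at distance less than 2/(k+1) < e from t *)
  have [k ke] : exists k : nat, k.+1%:R^-1 < e / 2.
    have [k _ kP] := near_infty_natSinv_lt (PosNum (divr_gt0 e0 (ltr0n _ 2))).
    by exists k; apply: kP => /=.
  have k0 : 0 < k.+1%:R^-1 :> R by rewrite invr_gt0.
  have /choice[q qt] (i : 'I_d) : exists q : rat,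
      `|pt t ord0 i - ratr q| < k.+1%:R^-1.
    have /rat_in_itvoo[q] : pt t ord0 i - k.+1%:R^-1 < pt t ord0 i.
      by rewrite ltrBlDr ltrDl.
    rewrite in_itv/= => /andP[q1 q2]; exists q.
    by rewrite ger0_norm ?subr_ge0 ?(ltW q2)// ltrBlDr -ltrBlDl.
  exists (\row_i q i, k) => //; rewrite /F/=.
  have tB : tuple_cube (fun i => ratr ((\row_i q i) ord0 i)) k.+1%:R^-1 t.
    by move=> i; rewrite [in ratr _]mxE.
  case: asboolP => // -[] s sB; apply: eU; split => // i j.
  rewrite /ball/= ord1.
  have := sB j; rewrite /= [in ratr _]mxE distrC => sqr.
  rewrite (le_lt_trans (ler_distD (ratr (q j)) _ _))//.
  by rewrite (splitr e) ltrD// (lt_trans _ ke).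
apply: countable_bigcupT_measurable => // p.
by rewrite /F; case: ifP => _ //; exact: measurable_tuple_cube.
Qed.

Lemma leb_tuple_cube (R : realType) (d : nat) (q : 'I_d -> R) (e : R) : 0 < e ->
  leb R d (tuple_cube q e) = ((e *+ 2) ^+ d)%:E.
Proof.
move=> e0; elim: d q => [|d IH] q.
  rewrite /= /lebesgue_tuple0 (_ : tuple_cube q e = setT) ?diracT//.
  by apply/seteqP; split => // t _ [].
rewrite /= /lebesgue_tuple_step /pushforward.
have -> : @consp R d @^-1` tuple_cube q e =
    (`](q ord0 - e), (q ord0 + e)[%classic : set R) `*`
    tuple_cube (fun i => q (lift ord0 i)) e.
  apply/seteqP; split => -[x t] /=.
    move=> qt; split; first by have := qt ord0; rewrite mxE in_itv/= ltr_distl.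
    by move=> i; have := qt (lift ord0 i); rewrite !mxE tnthS.
  rewrite in_itv/= => -[qx qt] i; case: (unliftP ord0 i) => [j|] ->.
    by have := qt j; rewrite !mxE tnthS.
  by rewrite mxE ltr_distl.
rewrite product_measure1E//; last exact: measurable_tuple_cube.
have len : lebesgue_measure (`](q ord0 - e), (q ord0 + e)[%classic : set R) =
    (e *+ 2)%:E.
  rewrite lebesgue_measure_itv/= lte_fin ifT; last by lra.
  by rewrite -EFinB; congr (_%:E); ring.
by rewrite IH exprS EFinM; congr (_ * _)%E; exact: len.
Qed.

Lemma volume_gt0 (R : realType) (d : nat) (U : set 'rV[R]_d) :
  open U -> U !=set0 -> (0 < volume U)%E.
Proof.
move=> oU [x Ux].
have /nbhs_ballP[e /= e0 eU] : nbhs x U by exact: open_nbhs_nbhs.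
rewrite (@lt_le_trans _ _ (leb R d (tuple_cube (fun i => x ord0 i) e)))//.
  by rewrite leb_tuple_cube// lte_fin exprn_gt0// pmulrn_lgt0.
apply: le_measure; rewrite ?inE; [exact: measurable_tuple_cube| |].
  exact: measurable_open.
move=> t xt; apply: eU; split => // i j; rewrite /ball/= distrC.
by rewrite ord1; exact: xt.
Qed.

Lemma volume_lt_pinfty (R : realType) (d : nat) (U : set 'rV[R]_d) (r : R) :
  open U -> (forall x, U x -> enorm x <= r) -> (volume U < +oo)%E.
Proof.
move=> oU Ur.
rewrite (@le_lt_trans _ _
  (leb R d (tuple_cube (fun=> 0) (`|r| + 1))))//; last first.
  by rewrite leb_tuple_cube ?ltry// ltr_wpDl.
apply: le_measure; rewrite ?inE; [exact: measurable_open| |].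
  exact: measurable_tuple_cube.
move=> t /Ur tr i; rewrite subr0.
have : `|pt t ord0 i| <= enorm (pt t).
  rewrite -sqrtr_sqr ler_wsqrtr// /dotp (bigD1 i)//= -expr2 lerDl.
  by apply: sumr_ge0 => j _; rewrite -expr2 sqr_ge0.
move=> /le_trans/(_ tr) tir; rewrite (le_lt_trans tir)//.
by rewrite ltr_pwDr// ler_norm.
Qed.

Lemma open_open_polytope (R : realType) (d : nat) (K : set 'rV[R]_d) :
  open_polytope K -> open K.
Proof.
move=> [_ [hs ->]].
elim: hs => [|h hs IH].
  by rewrite (_ : mkset _ = setT); [exact: openT|apply/seteqP; split].
rewrite (_ : mkset _ = [set x | dotp h.1 x < h.2] `&`
    [set x | forall h, h \in hs -> dotp h.1 x < h.2]); last first.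
  apply/seteqP; split => x /=.
    move=> hx; split; first by apply: hx; rewrite mem_head.
    by move=> k kin; apply: hx; rewrite in_cons kin orbT.
  by move=> [h1 h2] k; rewrite in_cons => /predU1P[->//|]; exact: h2.
apply: openI => //.
have ch : continuous (fun x : 'rV[R]_d => dotp h.1 x).
  apply: continuous_big => [|i _]; first exact: add_continuous.
  move=> x; have cx := @coord_continuous R 1 d ord0 i x.
  exact: cvgM (cvg_cst (h.1 ord0 i)) cx.
exact: (open_comp (fun x _ => ch x) (@open_lt R h.2)).
Qed.

Section means.
Context (R : realType) (d : nat) (K : set 'rV[R]_d).
Hypotheses (oK : open K) (K_gt0 : (0 < volume K)%E)
           (K_lty : (volume K < +oo)%E).

Let mK : measurable (@pt R d @^-1` K) := measurable_open oK.

Let fvol_gt0 : 0 < fine (volume K).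
Proof. by rewrite fine_gt0// K_gt0. Qed.

Lemma vintegrable_bounded (f : 'rV[R]_d -> R) (l u : R) :
  vmeasurable K f -> (forall x, K x -> l <= f x <= u) -> vintegrable K f.
Proof.
move=> mf bf; apply: measurable_bounded_integrable => //.
exists (`|l| + `|u|); split => // M lM t Kt; apply: (le_trans _ (ltW lM)).
have /andP[] := bf _ Kt; rewrite ler_norml.
have := ler_norm u; have := ler_norm (- l); rewrite normrN.
have := normr_ge0 u; have := normr_ge0 l; lra.
Qed.

Lemma cell_mean_bounds (f : 'rV[R]_d -> R) (l u : R) :
  vmeasurable K f -> (forall x, K x -> l <= f x <= u) ->
  l <= cell_mean K f <= u.
Proof.
move=> mf bf.
have If := vintegrable_bounded mf bf.
have Ic r : (leb R d).-integrable (@pt R d @^-1` K) (EFin \o cst r).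
  apply: measurable_bounded_integrable => //.
  by exists `|r|; split => // x rx y _; exact: ltW.
rewrite /cell_mean mulrC ler_pdivlMr// ler_pdivrMr//.
rewrite -!(@Rintegral_cst _ _ _ (leb R d) _ mK).
by apply/andP; split; apply: le_Rintegral => //;
  [exact: Ic|move=> t /bf/andP[]|exact: Ic|move=> t /bf/andP[]].
Qed.

Lemma cell_mean_sum (n : nat) (f : 'I_n -> 'rV[R]_d -> R) :
  (forall i, vintegrable K (f i)) ->
  \sum_(i < n) cell_mean K (f i) = cell_mean K (fun x => \sum_(i < n) f i x).
Proof.
move=> If; rewrite -mulr_sumr; congr *%R.
rewrite /vintegral.
under [in RHS]eq_integral do rewrite -sumEFin.
rewrite integral_sum// -sum_fine// => i _.
exact: integrable_fin_num (If i).
Qed.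
End means.

Local Close Scope classical_set_scope.

(** * The coefficients away from 0 and 1 *)

Lemma powR_01 (R : realType) (x g : R) : 0 < x <= 1 -> 0 <= g ->
  0 < x `^ g <= 1.
Proof.
move=> /andP[x0 x1] g0; rewrite powR_gt0//=.
by rewrite -(powRr0 x) ger_powR// x0 x1.
Qed.

Section coefficients.
Context (R : realType) (d n : nat) (P : problem R d n).
Hypotheses (A3 : assumption_A3 P) (A4 : assumption_A4 P).

Lemma gammas : [/\ 0 < gamma0 P, 0 < gamma1 P & 0 < gamma2 P].
Proof. by case: A3 => ? ? ? _ _; split; lra. Qed.

(** In b / a the common factor S^gamma0 / (S^gamma0 + (1-S)^gamma1) cancels. *)
Lemma coef_ratioE (s : R) : 0 < s < 1 ->
  coef_b P s / coef_a P s = (s `^ gamma2 P)^-1 + ((1 - s) `^ gamma1 P)^-1.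
Proof.
move=> /andP[s0 s1]; rewrite /coef_b /coef_a.
have := powR_gt0 (gamma0 P) s0; have := powR_gt0 (gamma2 P) s0.
have : 0 < 1 - s by rewrite subr_gt0.
move=> /(powR_gt0 (gamma1 P)).
move: (_ `^ _) (_ `^ gamma2 P) (_ `^ gamma0 P) => y z x y0 z0 x0.
field; rewrite !gt_eqF//= addr_gt0//.
Qed.

(** psi has slope at least 1: by [coef_ratioE], psi' is a sum of reciprocals of
positive powers of numbers in ]0, 1]. *)
Lemma coef_ratio_ge1 (s : R) : 0 < s < 1 -> 1 <= coef_b P s / coef_a P s.
Proof.
move=> s01; rewrite coef_ratioE//; have [_ g1 g2] := gammas.
have /andP[s0 s1] := s01.
have /andP[z0 z1] : 0 < s `^ gamma2 P <= 1.
  by apply: powR_01; rewrite ?s0 ltW.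
have /andP[y0 _] : 0 < (1 - s) `^ gamma1 P <= 1.
  by apply: powR_01; lra.
rewrite (le_trans (_ : 1 <= (s `^ gamma2 P)^-1))//; first by rewrite invf_ge1.
by rewrite lerDl invr_ge0 ltW.
Qed.

Lemma coef_b_gt0 (s : R) : 0 < s < 1 -> 0 < coef_b P s.
Proof.
move=> /andP[s0 s1]; rewrite /coef_b.
have := powR_gt0 (gamma0 P) s0; have := powR_gt0 (gamma2 P) s0.
have : 0 < 1 - s by rewrite subr_gt0.
move=> /(powR_gt0 (gamma1 P)).
move: (_ `^ _) (_ `^ gamma2 P) (_ `^ gamma0 P) => y z x y0 z0 x0.
by rewrite mulr_gt0// ?divr_gt0 ?addr_gt0// divr_gt0.
Qed.

Lemma Pc_derive_gt0 (s : R) : 0 < s < 1 ->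
  0 < s `^ (- p0 P) + (1 - s) `^ (- p1 P).
Proof.
by move=> /andP[s0 s1]; rewrite addr_gt0// powR_gt0// subr_gt0.
Qed.

Lemma beta_strict (s t : R) : 0 < s -> s < t -> t < 1 -> beta P s < beta P t.
Proof.
case: A3 => _ _ _ _ bD s0 st t1; apply: (@derive_gt0_lt R _ (coef_b P)) => //.
  by move=> x sxt; apply: bD; lra.
by move=> x sxt; apply: coef_b_gt0; lra.
Qed.

Lemma Pc_strict (s t : R) : 0 < s -> s < t -> t < 1 -> Pc P s < Pc P t.
Proof.
case: A4 => _ _ pD s0 st t1.
apply: (@derive_gt0_lt R _
  (fun s : R => s `^ (- p0 P) + (1 - s) `^ (- p1 P))) => //.
  by move=> x sxt; apply: pD; lra.
by move=> x sxt; apply: Pc_derive_gt0; lra.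
Qed.

Lemma le_beta (s t : R) : 0 < s -> s <= t -> t < 1 -> beta P s <= beta P t.
Proof.
move=> s0; rewrite le_eqVlt => /predU1P[->//|st t1].
exact/ltW/beta_strict.
Qed.

Lemma le_Pc (s t : R) : 0 < s -> s <= t -> t < 1 -> Pc P s <= Pc P t.
Proof.
move=> s0; rewrite le_eqVlt => /predU1P[->//|st t1].
exact/ltW/Pc_strict.
Qed.

Section range.
Variable e : R.
Hypothesis e_gt0 : 0 < e.

(** The range in which the maximum principle keeps all saturations. *)
Definition nondegenerate (s : R) := e <= s <= 1 - e.

Lemma nondegenerate01 (s : R) : nondegenerate s -> 0 < s < 1.
Proof. by have e0 := e_gt0; rewrite /nondegenerate; lra. Qed.

Lemma powR_range (s : R) : nondegenerate s ->
  [/\ e `^ gamma0 P <= s `^ gamma0 P <= 1,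
      e `^ gamma1 P <= (1 - s) `^ gamma1 P <= 1 &
      e `^ gamma2 P <= s `^ gamma2 P <= 1].
Proof.
have e0 := e_gt0.
move=> /andP[es s1]; have [g0 g1 g2] := gammas.
have E (x g : R) : 0 < g -> e <= x -> x <= 1 -> e `^ g <= x `^ g <= 1.
  move=> gg ex x1; rewrite ge0_ler_powR ?nnegrE; try lra.
  have x01 : 0 < x <= 1 by rewrite (lt_le_trans e_gt0 ex).
  by have /andP[] := powR_01 x01 (ltW gg).
move: es s1; rewrite lerBrDr => es s1.
by split; apply: E => //; lra.
Qed.

Definition b_min := e `^ gamma0 P / 2.
Definition b_max := 1 + (e `^ gamma2 P)^-1.
Definition dPc_max := (e `^ gamma2 P)^-1 + (e `^ gamma1 P)^-1.

Lemma b_min_gt0 : 0 < b_min.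
Proof. by rewrite divr_gt0// powR_gt0. Qed.

Lemma b_max_gt0 : 0 < b_max.
Proof. by rewrite addr_gt0// invr_gt0 powR_gt0. Qed.

Lemma dPc_max_gt0 : 0 < dPc_max.
Proof. by rewrite addr_gt0// invr_gt0 powR_gt0. Qed.

(** The denominator of b is at most 2, and its first factor is at most 1. *)
Lemma coef_b_bounds (s : R) : nondegenerate s -> b_min <= coef_b P s <= b_max.
Proof.
move=> sr; have [] := powR_range sr.
rewrite /b_min /b_max /coef_b.
have := powR_gt0 (gamma0 P) e_gt0; have := powR_gt0 (gamma2 P) e_gt0.
have := powR_gt0 (gamma1 P) e_gt0.
move: (e `^ _) (e `^ gamma2 P) (e `^ gamma0 P) => ye ze xe ye0 ze0 xe0.
move: (_ `^ _) (_ `^ gamma1 P) (_ `^ gamma2 P) => x y z.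
move=> /andP[x1 x2] /andP[y1 y2] /andP[z1 z2].
have x0 : 0 < x by lra. have y0 : 0 < y by lra. have z0 : 0 < z by lra.
have q0 : 0 <= y / z by rewrite divr_ge0// ltW.
apply/andP; split.
  apply: (@le_trans _ _ (x / (x + y))).
    apply: ler_pM; [lra|by rewrite invr_ge0| done|].
    by rewrite lef_pV2 ?posrE; lra.
  rewrite ler_peMr ?lerDl// divr_ge0; lra.
rewrite -[leRHS]mul1r; apply: ler_pM; [by rewrite divr_ge0; lra|lra| |].
  by rewrite ler_pdivrMr; lra.
rewrite lerD2l -[leRHS]mul1r; apply: ler_pM;
  [lra|by rewrite invr_ge0; lra|done|].
by rewrite lef_pV2 ?posrE.
Qed.

(** On ]0, 1] a smaller exponent gives a larger power, so p0 <= gamma2 and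
p1 <= gamma1 replace the exponents of P_c' by those of psi'. *)
Lemma dPc_bounds (s : R) : nondegenerate s ->
  0 <= s `^ (- p0 P) + (1 - s) `^ (- p1 P) <= dPc_max.
Proof.
move=> sr; have s01 := nondegenerate01 sr.
rewrite (ltW (Pc_derive_gt0 s01))/=; case: A4 => p02 p11 _.
have [_ /andP[y1 y2] /andP[z1 z2]] := powR_range sr.
have E (x p g : R) : 0 < x <= 1 -> p <= g -> e `^ g <= x `^ g ->
    x `^ (- p) <= (e `^ g)^-1.
  move=> x01 pg eg; apply: (@le_trans _ _ (x `^ (- g))).
    by apply: ger_powR => //; rewrite lerN2.
  rewrite powRN lef_pV2// posrE powR_gt0//; lra.
by apply: lerD; apply: E => //; lra.
Qed.

Lemma coef_ratio_bounded : exists B : R, forall s : R, nondegenerate s ->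
  `|coef_b P s / coef_a P s| <= B.
Proof.
exists dPc_max => s sr; have s01 := nondegenerate01 sr.
rewrite ger0_norm; last by have := coef_ratio_ge1 s01; lra.
rewrite coef_ratioE// /dPc_max.
have [_ /andP[y1 y2] /andP[z1 z2]] := powR_range sr.
have e1 := powR_gt0 (gamma1 P) e_gt0; have e2 := powR_gt0 (gamma2 P) e_gt0.
by apply: lerD; rewrite lef_pV2 ?posrE//; lra.
Qed.

(** The closed form of b / a makes its measurability immediate. *)
Lemma measurable_coef_ratio :
  measurable_fun `[e, 1 - e]%classic (fun s : R => coef_b P s / coef_a P s).
Proof.
apply: (@eq_measurable_fun _ _ _ _ _
    (fun s : R => s `^ (- gamma2 P) + (1 - s) `^ (- gamma1 P))).
  move=> s; rewrite inE/= in_itv/= => sr.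
  by rewrite coef_ratioE ?nondegenerate01// !powRN.
apply: measurable_funTS; apply: measurable_funD; first exact: measurable_powR.
apply: (measurableT_comp (measurable_powR (- gamma1 P))).
by apply: measurable_funB.
Qed.

Hypothesis sD_range : nondegenerate (tot_sat (SD P)).

Lemma psi_increment (s t : R) : e <= s -> s <= t -> t <= 1 - e ->
  t - s <= psi P t - psi P s.
Proof.
move=> es st te; have [B bB] := coef_ratio_bounded.
have /(_ (tot_sat (SD P)) s t 1 B) := primitive_increment_bounds
  measurable_coef_ratio (ex_intro _ B bB).
rewrite mul1r => H.
suff /(H sD_range es st te)/andP[] : forall x : R, s <= x <= t ->
    1 <= coef_b P x / coef_a P x <= B by [].

move=> x sxt; rewrite coef_ratio_ge1 ?nondegenerate01//=; last first.
  by rewrite /nondegenerate; lra.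
by rewrite (le_trans (ler_norm _))// bB// /nondegenerate; lra.
Qed.

Lemma psi_sD : psi P (tot_sat (SD P)) = 0.
Proof.
rewrite /psi /oriented_integral lexx.
by rewrite set_itv1 Rintegral_set1.
Qed.

Lemma Psi_sD : Psi P (tot_sat (SD P)) = 0.
Proof.
rewrite /Psi /oriented_integral lexx.
by rewrite set_itv1 Rintegral_set1.
Qed.

Lemma Psi_increment (s t : R) : e <= s -> s <= t -> t <= 1 - e ->
  psi P s * (t - s) <= Psi P t - Psi P s <= psi P t * (t - s).
Proof.
move=> es st te.
have psi_homo (x y : R) : nondegenerate x -> nondegenerate y -> x <= y ->
    psi P x <= psi P y.
  move=> /andP[x1 x2] /andP[y1 y2] xy.
  by have := psi_increment x1 xy y2; lra.
have er : nondegenerate e by rewrite /nondegenerate; lra.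
have er' : nondegenerate (1 - e) by rewrite /nondegenerate; lra.
apply: (@primitive_increment_bounds R e (1 - e) (psi P)) => //.
- apply: (@eq_measurable_fun _ _ _ _ _
      (fun x : R => psi P (Num.max e (Num.min x (1 - e))))).
    move=> x; rewrite inE/= in_itv/= => /andP[ex xe].
    by rewrite min_l// max_r.
  (* psi is monotone only on [e, 1 - e]: clipping the argument to this interval
     makes it monotone on the whole line *)
  apply: nondecreasing_measurable => // x y xy.
  have clip (z : R) : nondegenerate (Num.max e (Num.min z (1 - e))).
    by rewrite /nondegenerate le_max lexx/= ge_max ge_min lexx orbT andbT; lra.
  apply: psi_homo => //.
  by rewrite ge_max !le_max lexx/=  le_min !ge_min xy lexx/= !orbT.
- exists (`|psi P e| + `|psi P (1 - e)|) => x xr.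
  have := psi_homo _ _ er xr; have := psi_homo _ _ xr er'.
  have /andP[x1 x2] := xr.
  move=> /(_ x2) h1 /(_ x1) h2; rewrite ler_norml.
  have := ler_norm (psi P (1 - e)); have := ler_norm (- psi P e).
  have := normr_ge0 (psi P e); have := normr_ge0 (psi P (1 - e)).
  by rewrite normrN; lra.
- by move=> x sxt; rewrite !psi_homo// /nondegenerate; lra.
Qed.

(** Psi' = psi is increasing, so Psi lies above its tangents. *)
Lemma Psi_convex (s t : R) : nondegenerate s -> nondegenerate t ->
  Psi P s - Psi P t <= psi P s * (s - t).
Proof.
move=> /andP[s1 s2] /andP[t1 t2]; case: (leP s t) => [st|/ltW ts].
  by have := Psi_increment s1 st t2; lra.
by have := Psi_increment t1 ts s2; lra.
Qed.

(** S^D is the minimum of Psi: its tangent there is 0. *)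
Lemma Psi_ge0 (s : R) : nondegenerate s -> 0 <= Psi P s.
Proof.
move=> sr; have := Psi_convex sD_range sr.
by rewrite psi_sD Psi_sD mul0r; lra.
Qed.

Lemma beta_increment (s t : R) : e <= s -> s <= t -> t <= 1 - e ->
  b_min * (t - s) <= beta P t - beta P s <= b_max * (t - s).
Proof.
have e0 := e_gt0.
move=> es st te; case: A3 => _ _ _ _ bD.
apply: (@increment_bounds _ _ (coef_b P)) => // x sxt.
  by apply: bD; lra.
by apply: coef_b_bounds; rewrite /nondegenerate; lra.
Qed.

Lemma Pc_increment (s t : R) : e <= s -> s <= t -> t <= 1 - e ->
  0 <= Pc P t - Pc P s <= dPc_max * (t - s).
Proof.
have e0 := e_gt0.
move=> es st te; case: A4 => _ _ pD; rewrite -[X in X <= _](mul0r (t - s)).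
apply: (@increment_bounds _ _
  (fun s : R => s `^ (- p0 P) + (1 - s) `^ (- p1 P))) => // x sxt.
  by apply: pD; lra.
by apply: dPc_bounds; rewrite /nondegenerate; lra.
Qed.

End range.
End coefficients.

(** * Summing the fluxes over the components *)

Lemma tot_sat_gt0 (R : realType) (n : nat) (S : 'rV[R]_n) :
  (0 < n)%N -> saturation_set S -> 0 < tot_sat S.
Proof.
move=> n0 [S0 _]; rewrite /tot_sat (bigD1 (Ordinal n0))//=.
by rewrite ltr_pwDl// sumr_ge0// => i _; exact: ltW.
Qed.

Lemma sum_composition (R : realType) (n : nat) (S : 'rV[R]_n) :
  (0 < n)%N -> saturation_set S -> \sum_(i < n) composition S i = 1.
Proof.
by move=> n0 SP; rewrite -mulr_suml divff// gt_eqF// tot_sat_gt0.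
Qed.

Lemma composition_gt0 (R : realType) (n : nat) (S : 'rV[R]_n) i :
  (0 < n)%N -> saturation_set S -> 0 < composition S i.
Proof. by move=> n0 SP; rewrite divr_gt0 ?tot_sat_gt0//; case: SP. Qed.

Lemma log_mean_gt0 (R : realType) (x y : R) :
  0 < x -> 0 < y -> x != y -> 0 < log_mean x y.
Proof.
move=> x0 y0; rewrite neq_lt /log_mean => /orP[xy|yx].
  by rewrite divr_gt0// subr_gt0// ltr_ln.
by rewrite -mulrNN -invrN !opprB divr_gt0// subr_gt0// ltr_ln.
Qed.

(** The factor 1/m_s is chosen for this: over the components whose fractions
differ, the c_{i,s} add up to 1 minus the fractions that agree. *)
Lemma sum_face_fraction (R : realType) (n : nat) (cK cL : 'I_n -> R) :
  (forall i, 0 < cK i) -> (forall i, 0 < cL i) -> \sum_(i < n) cK i = 1 ->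
  \sum_(i < n) face_fraction cK cL i = 1.
Proof.
move=> cK0 cL0 cK1; rewrite /face_fraction.
have c1 : \sum_(i < n | cK i != cL i) cK i =
    1 - \sum_(i < n | cK i == cL i) cK i.
  rewrite -[X in X - _]cK1 [in RHS](bigID (fun i => cK i == cL i))/=.
  by rewrite addrAC subrr add0r.
have [[i ci]|nc] := pselect (exists i, cK i != cL i); last first.
  rewrite -[RHS]cK1; apply: eq_bigr => i _.
  by case: eqVneq => // ci; exfalso; apply: nc; exists i.
have pos (f : 'I_n -> R) : (forall j, cK j != cL j -> 0 < f j) ->
    0 < \sum_(j < n | cK j != cL j) f j.
  move=> f0; rewrite (bigD1 i)//= ltr_pwDl ?f0// sumr_ge0// => j /andP[cj _].
  exact/ltW/f0.
have m0 := pos _ (fun j cj => log_mean_gt0 (cK0 j) (cL0 j) cj).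
have s0 := pos _ (fun j _ => cK0 j).
rewrite (bigID (fun i => cK i == cL i))/=.
rewrite (eq_bigr cK); last by move=> j ->.
rewrite [X in _ + X](eq_bigr (fun j => (\sum_(j < n | cK j != cL j)
    log_mean (cK j) (cL j))^-1 * (\sum_(j < n | cK j != cL j) cK j)
    * log_mean (cK j) (cL j))); last first.
  by move=> j /negbTE ->; rewrite c1 invfM invrK mulrC [_^-1 * _]mulrC mulrC.
rewrite -mulr_sumr mulrAC mulVf ?gt_eqF// mul1r c1; ring.
Qed.

(** Along the line (1,...,1) + t e_j the form is nonnegative and equal to
2 t x + t^2 A_jj with x the j-th column sum, because (1,...,1) has zero
projection and so makes the form vanish. A linear term that never turns the sum
negative is zero. *)
Lemma quad_colsum0 (R : realType) (n : nat) (A : 'M[R]_n) (C : R) :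
  A^T = A -> (forall z, 0 <= quad A z <= C * enorm (proj_mean0 z) ^+ 2) ->
  forall j, \sum_(i < n) A i j = 0.
Proof.
move=> As Aq j.
have n0 : (n%:R : R) != 0 by rewrite pnatr_eq0; case: n j {As Aq A} => // -[].
have q1 : quad A (const_mx 1) = 0.
  have p1 : proj_mean0 (const_mx 1 : 'rV[R]_n) = 0.
    apply/rowP => k; rewrite !mxE.
    under eq_bigr => i _ do rewrite !mxE mul1r mulr1.
    rewrite sumrB sumr_const card_ord -[_ *+ n]mulr_natl mulfV//.
    rewrite (bigD1 k)//= eqxx big1 ?addr0 ?subrr// => i ik.
    by rewrite (negbTE ik).
  have := Aq (const_mx 1); rewrite p1 /enorm /dotp big1 ?sqrtr0.
    by rewrite expr0n/= mulr0 => /le_anti.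
  by move=> i _; rewrite mxE mul0r.
set x := \sum_(i < n) A i j.
have Asym a b : A a b = A b a by rewrite -[in LHS]As mxE.
pose v t : 'rV[R]_n := const_mx 1 + t *: delta_mx ord0 j.
have qE t : quad A (v t) = t * x *+ 2 + t ^+ 2 * A j j.
  have vE k : v t ord0 k = 1 + t * (k == j)%:R by rewrite !mxE eqxx.
  rewrite /quad; under eq_bigr => i _.
    under eq_bigr => k _ do rewrite !vE.
    rewrite (_ : \sum_(k < n) _ = \sum_(k < n) A i k
      + t * (i == j)%:R * \sum_(k < n) A i k
      + (1 + t * (i == j)%:R) * t * A i j); last first.
      rewrite (eq_bigr (fun k => A i k + t * (i == j)%:R * A i k
        + (1 + t * (i == j)%:R) * t * (A i k * (k == j)%:R))); last first.
        by move=> k _; ring.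
      rewrite !big_split/= -!mulr_sumr; congr (_ + _ * _).
      rewrite (bigD1 j)//= eqxx mulr1 big1 ?addr0// => k kj.
      by rewrite (negbTE kj) mulr0.
    over.
  have d (f : 'I_n -> R) : \sum_(i < n) (i == j)%:R * f i = f j.
    rewrite (bigD1 j)//= eqxx mul1r big1 ?addr0// => k kj.
    by rewrite (negbTE kj) mul0r.
  rewrite (eq_bigr (fun i => \sum_(k < n) A i k
      + t * ((i == j)%:R * \sum_(k < n) A i k)
      + (t * A i j + t ^+ 2 * ((i == j)%:R * A i j)))); last first.
    by move=> i _; ring.
  rewrite !big_split/= -!mulr_sumr !d -/x.
  have -> : \sum_(k < n) A j k = x by apply: eq_bigr => k _; rewrite Asym.
  have -> : \sum_(i < n) \sum_(k < n) A i k = 0.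
    rewrite -[RHS]q1; apply: eq_bigr => i _; apply: eq_bigr => k _.
    by rewrite !mxE !mulr1.
  ring.
(* the values at t = 1 and t = -1 add up to 2 A_jj *)
have a0 : 0 <= A j j.
  have h1 := qE 1; have h2 := qE (-1).
  have /andP[h3 _] := Aq (v 1); have /andP[h4 _] := Aq (v (-1)).
  by rewrite h1 in h3; rewrite h2 in h4; lra.
apply/eqP; apply: contraT => x0.
have x20 : 0 < x ^+ 2 by rewrite exprn_even_gt0.
(* the denominator A_jj + 1 is positive even if A_jj = 0, and this t makes the
   form negative *)
have /andP[+ _] := Aq (v (- x / (A j j + 1))).
rewrite qE leNgt => /negP[].
have a1 : 0 < A j j + 1 by lra.
rewrite (_ : _ + _ = - (x ^+ 2 * (A j j + 2) / (A j j + 1) ^+ 2)); last first.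
  by field; rewrite gt_eqF.
by rewrite oppr_lt0 divr_gt0 ?exprn_gt0// mulr_gt0//; lra.
Qed.

(** The log-sum inequality, from ln x <= x - 1 applied to each ratio
(T_i / S_i) (s / t). *)
Lemma entropy_ge0 (R : realType) (n : nat) (S T : 'I_n -> R) (s t : R) :
  (forall i, 0 < S i) -> (forall i, 0 < T i) -> 0 < s -> 0 < t ->
  \sum_(i < n) S i = s -> \sum_(i < n) T i = t ->
  0 <= \sum_(i < n) S i * ln (S i / T i) - s * ln (s / t).
Proof.
move=> S0 T0 s0 t0 Ss Tt.
rewrite -[X in _ - X * _]Ss mulr_suml -sumrB.
have e0 : 0 = \sum_(i < n) (S i - T i * (s / t)).
  by rewrite sumrB -mulr_suml Ss Tt; field; rewrite gt_eqF.
rewrite [leLHS]e0; apply: ler_sum => i _.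
have Si0 : S i != 0 by rewrite gt_eqF.
have s1 : s != 0 by rewrite gt_eqF. have t1 : t != 0 by rewrite gt_eqF.
have Ti0 : T i != 0 by rewrite gt_eqF.
have -> : ln (S i / T i) = ln (s / t) - ln ((T i / S i) * (s / t)).
  rewrite -ln_div ?posrE ?mulr_gt0 ?invr_gt0//; congr ln.
  by field; rewrite Si0 Ti0 s1 t1.
rewrite -mulrBr addrAC subrr add0r.
have : ln ((T i / S i) * (s / t)) <= (T i / S i) * (s / t) - 1.
  rewrite -[X in ln X](subrKC 1); apply: le_ln1Dx.
  by rewrite -subr_gt0 opprK subrK !mulr_gt0 ?invr_gt0.
move=> /(ler_wpM2l (ltW (S0 i))) h.
have e : S i * (T i / S i * (s / t) - 1) = T i * (s / t) - S i.
  by field; rewrite Si0 t1.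
by rewrite mulrN; lra.
Qed.

(** * Discrete integration by parts *)

Section faces.
Context (R : realType) (d n : nat) (P : problem R d n) (m : mesh R d).
Implicit Types (K L : cell m) (s : face m).

Lemma face_value_ind (V : Type) (Q : V -> Prop) (vD : V) (v : cell m -> V) K s :
  Q vD -> (forall L, Q (v L)) -> Q (face_value P vD v K s).
Proof.
by move=> QD Qv; rewrite /face_value; case: neighbor => //; case: ifP.
Qed.

Lemma face_value_map (V W : Type) (f : V -> W) (vD : V) (v : cell m -> V) K s :
  face_value P (f vD) (fun L => f (v L)) K s = f (face_value P vD v K s).
Proof. by rewrite /face_value; case: neighbor => //; case: ifP. Qed.

Lemma transmissibility_ge0 s : 0 <= transmissibility s.
Proof.
rewrite divr_ge0//.
  rewrite fine_ge0// /hausdorff.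
  apply: le_ereal_sup_tmp.
  exists (hausdorff_pre d.-1 1 (face_set m s)); first by exists 1 => //=.
  apply: le_ereal_inf_tmp => _ /= [U _ <-].
  apply: nneseries_ge0 => i _ _; rewrite /hausdorff_gauge; case: ifP => // _.
  rewrite lee_fin mulr_ge0 ?fine_ge0// exprn_ge0// divr_ge0//.
  rewrite /diam; have [->|/set0P[x Ux]] := eqVneq (U i) set0.
    rewrite [X in ereal_sup X](_ : _ = set0%classic) ?ereal_sup0//.
    by rewrite -subset0 => z [x []].
  rewrite fine_ge0//; apply: ereal_sup_ubound; exists x => //; exists x => //.
  by rewrite subrr /enorm /dotp big1 ?sqrtr0// => j _; rewrite mxE mul0r.
rewrite /face_distance; case: neighbor => [L|]; first exact: sqrtr_ge0.
have [->|/set0P ne] := eqVneq (face_set m s) set0.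
  by rewrite image_set0 inf0.
apply: lb_le_inf; first by case: ne => y sy; eexists; exists y.
by move=> _ [y _ <-]; exact: sqrtr_ge0.
Qed.

Hypothesis adm : admissible P m.

Lemma face_cell_faces s : s \in faces m (face_cell m s).
Proof. by case: adm => _ [_ _ _ _ +] _ _; exact. Qed.

(** Either [face_cell s] and one other cell share the face and are each other's
neighbor across it, or the face lies on the boundary. *)
Lemma face_cases s :
  (exists L, [/\ L != face_cell m s, neighbor (face_cell m s) s = Some L,
     neighbor L s = Some (face_cell m s) &
     forall J, (s \in faces m J) = (J == face_cell m s) || (J == L)]) \/
  (neighbor (face_cell m s) s = None /\
     forall J, (s \in faces m J) = (J == face_cell m s)).
Proof.
have nbE K L : K != L ->
    (forall J, (s \in faces m J) = (J == K) || (J == L)) ->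
    neighbor K s = Some L.
  move=> KL sE; rewrite /neighbor; case: pickP => [J|/(_ L)].
    by rewrite sE => /andP[/negbTE ->]/= /eqP ->.
  by rewrite sE eqxx orbT eq_sym KL.
case: adm => _ _ [_ /(_ s)] [[K [L [KL _ sE]]]|[K sE _]] _.
- left; have := face_cell_faces s; rewrite sE => /orP[] /eqP ->.
    exists L; split => //; [by rewrite eq_sym|exact: nbE|].
    by apply: nbE; [rewrite eq_sym|move=> J; rewrite sE orbC].
  exists K; split => //; [|exact: nbE|by move=> J; rewrite sE orbC].
  by apply: nbE; [rewrite eq_sym|move=> J; rewrite sE orbC].
- right; have := face_cell_faces s; rewrite sE => /eqP ->; split => //.
  rewrite /neighbor; case: pickP => // J; rewrite sE.
  by case: eqP.
Qed.

(** Boundary faces contribute too: [u] vanishes on the Dirichlet part, where its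
jump is -u_K, and both jumps vanish on the Neumann part. *)
Lemma summation_by_parts (g : cell m -> face m -> R) (vD : R)
    (v u : cell m -> R) :
  (forall K L s, neighbor K s = Some L -> neighbor L s = Some K ->
     g L s = g K s) ->
  \sum_K (\sum_(s in faces m K) g K s * face_jump P vD v K s) * u K =
  - \sum_s g (face_cell m s) s * face_jump P vD v (face_cell m s) s
             * face_jump P 0 u (face_cell m s) s.
Proof.
move=> gsym; rewrite -sumrN.
under eq_bigr do rewrite mulr_suml big_mkcond/=.
rewrite exchange_big/=; apply: eq_bigr => s _; rewrite -big_mkcond/=.
set K := face_cell m s.
have [[L [LK KL LK' sE]]|[KN sE]] := face_cases s.
  rewrite (eq_bigl _ _ sE) (bigD1 K)/=; last by rewrite eqxx.
  rewrite (big_pred1 L); last first.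
    move=> J /=; case: (eqVneq J K) => [->|]/=; last by rewrite andbT.
    by rewrite eq_sym (negbTE LK).
  by rewrite /face_jump /face_value KL LK' (gsym K L)//; ring.
rewrite (big_pred1 K) // /face_jump /face_value KN.
by case: ifP => _; ring.
Qed.

End faces.

Lemma face_mobilityC (R : realType) (d n : nat) (P : problem R d n) (x y : R) :
  face_mobility P x y = face_mobility P y x.
Proof.
rewrite /face_mobility eq_sym; case: eqP => [->//|_].
by rewrite -[RHS]mulrNN -invrN !opprB.
Qed.

(** * The discrete maximum principle *)

Section scalar_scheme.
Context (R : realType) (d n : nat) (P : problem R d n) (m : mesh R d).
Hypotheses (A3 : assumption_A3 P) (A4 : assumption_A4 P).
Hypothesis adm : admissible P m.
Implicit Types (K L : cell m) (s : face m) (x y : cell m -> R).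
Let sD := tot_sat (SD P).
Hypothesis sD01 : 0 < sD < 1.

(** The interval used for [psi_increment] has to contain s, t and S^D. *)
Lemma psi_strict (s t : R) : 0 < s -> s < t -> t < 1 -> psi P s < psi P t.
Proof.
have /andP[D0 D1] := sD01 => s0 st t1.
pose e := Num.min (Num.min s sD) (Num.min (1 - t) (1 - sD)).
have e0 : 0 < e by rewrite !lt_min s0 D0 !subr_gt0 t1 D1.
have es : e <= s by rewrite !ge_min lexx.
have eD : e <= sD by rewrite !ge_min lexx orbT.
have et : e <= 1 - t by rewrite !ge_min lexx !orbT.
have eD' : e <= 1 - sD by rewrite !ge_min lexx !orbT.
have sDr : nondegenerate e (tot_sat (SD P)).
  by rewrite /nondegenerate -/sD eD lerBrDl -lerBrDr.
have te : t <= 1 - e by rewrite lerBrDl -lerBrDr.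
by have := psi_increment A3 e0 sDr es (ltW st) te; lra.
Qed.

Lemma face_mobility_ge0 (x y : R) : 0 < x < 1 -> 0 < y < 1 ->
  0 <= face_mobility P x y.
Proof.
wlog xy : x y / x <= y => [H x01 y01|].
  case: (leP x y) => [xy|/ltW yx]; first exact: H.
  by rewrite face_mobilityC; exact: H.
move=> /andP[x0 x1] /andP[y0 y1]; rewrite /face_mobility.
case: eqVneq => [_|yx].
  by rewrite /coef_a divr_ge0 ?mulr_ge0 ?addr_ge0 ?powR_ge0.
have {}xy : x < y by rewrite lt_neqAle eq_sym yx.
by rewrite divr_ge0// subr_ge0 ltW// (psi_strict, beta_strict A3).
Qed.

(** The discrete chain rule a_s D psi = D beta that motivates the definition of
a_s. *)
Lemma face_mobility_psi (x y : R) : 0 < x < 1 -> 0 < y < 1 ->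
  face_mobility P x y * (psi P y - psi P x) = beta P y - beta P x.
Proof.
move=> /andP[x0 x1] /andP[y0 y1]; rewrite /face_mobility.
case: eqVneq => [->|yx]; first by rewrite !subrr mulr0.
rewrite divfK// subr_eq0; move: yx; rewrite neq_lt => /orP[] yx.
  by rewrite lt_eqF// psi_strict.
by rewrite gt_eqF// psi_strict.
Qed.

Definition cell_mass K : R := cell_measure K * cell_mean (cell_set m K) (Phi P).

Definition conductance x K s : R :=
  transmissibility s * face_mobility P (x K) (face_value P sD x K s).

(** The scheme summed over the components and multiplied by [dt]. *)
Definition scalar_step (dt : R) x x' : Prop := forall K,
  cell_mass K * (x K - x' K) = dt * \sum_(s in faces m K)
    conductance x K s * face_jump P (Pc P sD)
      (fun L => Pc P (x L) + (beta P (x L) - beta P (x' L)) / dt) K s.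

Lemma conductanceC x K L s : neighbor K s = Some L -> neighbor L s = Some K ->
  conductance x L s = conductance x K s.
Proof.
by move=> KL LK; rewrite /conductance /face_value KL LK face_mobilityC.
Qed.

Lemma face_value01 x K s : (forall L, 0 < x L < 1) ->
  0 < face_value P sD x K s < 1.
Proof.
move=> x01.
exact: (@face_value_ind _ _ _ P m R (fun z : R => 0 < z < 1) sD x K s).
Qed.

Lemma conductance_ge0 x K s : (forall L, 0 < x L < 1) -> 0 <= conductance x K s.
Proof.
move=> x01; rewrite mulr_ge0 ?transmissibility_ge0 ?face_mobility_ge0//.
exact: face_value01.
Qed.

Section step.
Variables (dt : R) (x x' : cell m -> R).
Hypotheses (dt_gt0 : 0 < dt) (step : scalar_step dt x x')
  (x01 : forall K, 0 < x K < 1) (x'01 : forall K, 0 < x' K < 1)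
  (mass_gt0 : forall K, 0 < cell_mass K).

(** The factor [eps] = 1 or -1 gives the upper and the lower bound by one
argument: changing the signs of saturation, beta and P_c together preserves
both the step and the monotonicity of beta and P_c. [M] bounds the previous
iterate and the Dirichlet datum. *)
Lemma comparison_principle (eps M : R) : eps = 1 \/ eps = -1 -> 0 < M < 1 ->
  eps * sD <= eps * M -> (forall K, eps * x' K <= eps * M) ->
  forall K, eps * x K <= eps * M.
Proof.
move=> epsP M01 DM x'M L; rewrite leNgt; apply/negP => ML.
have mono (f : R -> R) :
    (forall s t : R, 0 < s -> s < t -> t < 1 -> f s < f t) ->
    forall s t : R, 0 < s < 1 -> 0 < t < 1 -> eps * s < eps * t ->
      eps * f s < eps * f t.
  move=> fm s t /andP[? ?] /andP[? ?].
  by case: epsP => ->; rewrite ?mul1r ?mulN1r ?ltrN2 => h; apply: fm.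
have wmono (f : R -> R) :
    (forall s t : R, 0 < s -> s < t -> t < 1 -> f s < f t) ->
    forall s t : R, 0 < s < 1 -> 0 < t < 1 -> eps * s <= eps * t ->
      eps * f s <= eps * f t.
  move=> fm s t s01 t01; rewrite le_eqVlt.
  move=> /predU1P[|/(mono f fm _ _ s01 t01)/ltW//].
  case: epsP => ->; first by rewrite !mul1r => ->.
  by rewrite !mulN1r => /oppr_inj ->.
have mb := mono _ (beta_strict A3); have wmb := wmono _ (beta_strict A3).
have mp := mono _ (Pc_strict A4); have wmp := wmono _ (Pc_strict A4).
pose v K := Pc P (x K) + (beta P (x K) - beta P (x' K)) / dt.
(* v attains its largest value, in the sense of eps, in K *)
have [K _ Kmax] := @arg_maxP _ _ _ L xpredT (fun K => eps * v K) isT.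
have vLE J : eps * v J = eps * Pc P (x J)
    + (eps * beta P (x J) - eps * beta P (x' J)) / dt.
  by rewrite /v; ring.
(* a cell L beyond M would push this maximum beyond P_c(M) *)
have vK : eps * Pc P M < eps * v K.
  apply: (@lt_le_trans _ _ (eps * v L)); last exact: Kmax.
  rewrite vLE ltr_pwDr//; last exact/wmp/ltW.
  by rewrite divr_gt0// subr_gt0 mb// (le_lt_trans (x'M L)).
have jump s : eps * face_jump P (Pc P sD) v K s <= 0.
  rewrite /face_jump mulrBr subr_le0.
  apply: (@face_value_ind _ _ _ P m R (fun z : R => eps * z <= eps * v K)
    _ v K s).
    by rewrite (le_trans _ (ltW vK))// wmp.
  by move=> J; exact: Kmax.
(* but at K all fluxes point outwards, so that the rate in v_K has the opposite
   sign *)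
have xx' : eps * x K <= eps * x' K.
  rewrite -subr_le0 -mulrBr -(pmulr_rle0 _ (mass_gt0 K)) mulrCA (step K).
  rewrite mulrCA pmulr_rle0// mulr_sumr sumr_le0// => s _.
  rewrite mulrCA mulr_ge0_le0 ?conductance_ge0//.
have : eps * v K <= eps * Pc P M.
  rewrite vLE; have := wmb _ _ (x01 K) (x'01 K) xx'; rewrite -subr_le0 => h.
  rewrite -[leRHS]addr0 lerD//; first exact/wmp/(le_trans xx').
  by rewrite pmulr_lle0 ?invr_gt0.
by rewrite leNgt vK.
Qed.

Lemma step_nondegenerate (e : R) : 0 < e -> nondegenerate e sD ->
  (forall K, nondegenerate e (x' K)) -> forall K, nondegenerate e (x K).
Proof.
move=> e0 Dr x'r K; rewrite /nondegenerate in Dr x'r *.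
have /andP[D1 D2] := Dr.
have lo : forall J, -1 * x J <= -1 * e.
  apply: comparison_principle; [by right|lra|by rewrite !mulN1r lerN2|].
  by move=> J; rewrite !mulN1r lerN2; have /andP[] := x'r J.
have up : forall J, 1 * x J <= 1 * (1 - e).
  apply: comparison_principle; [by left|lra|by rewrite !mul1r|].
  by move=> J; rewrite !mul1r; have /andP[] := x'r J.
by have := lo K; have := up K; rewrite !mul1r !mulN1r lerN2 => -> ->.
Qed.

(** * Energy and rate estimates *)

Lemma pressure_jump K s :
  face_jump P (Pc P sD)
    (fun L => Pc P (x L) + (beta P (x L) - beta P (x' L)) / dt) K s =
  face_jump P (Pc P sD) (fun L => Pc P (x L)) K s +
  face_jump P 0 (fun L => (beta P (x L) - beta P (x' L)) / dt) K s.
Proof.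
rewrite /face_jump /face_value; case: neighbor => [L|]; first by ring.
by case: ifP => _; ring.
Qed.

Lemma rate_jump K s :
  face_jump P 0 (fun L => (beta P (x L) - beta P (x' L)) / dt) K s =
  (face_jump P (beta P sD) (fun L => beta P (x L)) K s
   - face_jump P (beta P sD) (fun L => beta P (x' L)) K s) / dt.
Proof.
rewrite /face_jump /face_value; case: neighbor => [L|]; first by ring.
by case: ifP => _; ring.
Qed.

(** The weak form of [scalar_step] for a test function that vanishes on the
Dirichlet boundary. *)
Lemma test_step (u : cell m -> R) :
  \sum_K cell_mass K * (x K - x' K) * u K =
  - (dt * \sum_s conductance x (face_cell m s) s *
      face_jump P (Pc P sD)
        (fun L => Pc P (x L) + (beta P (x L) - beta P (x' L)) / dt)
        (face_cell m s) s * face_jump P 0 u (face_cell m s) s).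
Proof.
rewrite -mulrN -(summation_by_parts adm); last exact: conductanceC.
by rewrite mulr_sumr; apply: eq_bigr => K _; rewrite step mulrA.
Qed.

Variable e : R.
Hypotheses (e_gt0 : 0 < e) (Dr : nondegenerate e sD)
  (xr : forall K, nondegenerate e (x K))
  (x'r : forall K, nondegenerate e (x' K)).

Definition dirichlet_energy (y : cell m -> R) : R :=
  \sum_s transmissibility s *
    face_jump P (beta P sD) (fun L => beta P (y L)) (face_cell m s) s ^+ 2.

Definition scalar_energy (y : cell m -> R) : R :=
  \sum_K cell_mass K * Psi P (y K) + 2^-1 * dirichlet_energy y.

(** Test with psi(x). In the resulting face sum the capillary part D beta D P_c
is nonnegative, and D beta D (beta - beta') is at least half the difference of the
squares. *)
Lemma scalar_energy_decreases : scalar_energy x <= scalar_energy x'.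
Proof.
have h1 : \sum_K cell_mass K * Psi P (x K) - \sum_K cell_mass K * Psi P (x' K)
    <= \sum_K cell_mass K * (x K - x' K) * psi P (x K).
  rewrite -sumrB; apply: ler_sum => K _.
  rewrite -mulrBr -mulrA ler_pM2l// [leRHS]mulrC.
  exact: (Psi_convex A3 e_gt0 Dr).
suff h2 : 2^-1 * dirichlet_energy x - 2^-1 * dirichlet_energy x' <=
    - \sum_K cell_mass K * (x K - x' K) * psi P (x K).
  by rewrite /scalar_energy; lra.
rewrite test_step opprK -mulrBr -sumrB !mulr_sumr; apply: ler_sum => s _.
set K := face_cell m s.
rewrite pressure_jump rate_jump.
set b := face_jump P _ _ K s; set b' := face_jump P _ _ K s.
set p := face_jump P (Pc P sD) _ K s; set q := face_jump P 0 _ K s.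
set y := face_value P sD x K s.
have y01 : 0 < y < 1 by exact: face_value01.
have qE : q = psi P y - psi P (x K).
  by rewrite /q /face_jump -[X in face_value P X](psi_sD P) face_value_map.
have bE : b = beta P y - beta P (x K) by rewrite /b /face_jump face_value_map.
have pE : p = Pc P y - Pc P (x K) by rewrite /p /face_jump face_value_map.
have bp0 : 0 <= b * p.
  have /andP[xK0 xK1] := x01 K; have /andP[y0 y1] := y01.
  rewrite bE pE; case: (leP (x K) y) => xy.
    by rewrite mulr_ge0// subr_ge0 (le_beta A3, le_Pc A4).
  by rewrite mulr_le0// subr_le0 (le_beta A3, le_Pc A4) // ltW.
have cE : conductance x K s * (p + (b - b') / dt) * q =
    transmissibility s * (p + (b - b') / dt) * b.
  have fq : face_mobility P (x K) y * q = b.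
    by rewrite qE bE face_mobility_psi.
  by rewrite /conductance -/y -[X in _ = _ * X]fq; ring.
rewrite cE.
have -> : dt * (transmissibility s * (p + (b - b') / dt) * b) =
    transmissibility s * (dt * (b * p) + (b - b') * b).
  by field; rewrite gt_eqF.
rewrite -mulrBr mulrCA ler_wpM2l ?transmissibility_ge0//.
have : 0 <= dt * (b * p) by rewrite mulr_ge0// ltW.
have : 0 <= (b - b') ^+ 2 by exact: sqr_ge0.
nra.
Qed.

Definition mobility_const : R := dPc_max P e ^+ 2 / b_min P e.

(** Write h for the jump of the saturation. Then
a_s = D beta / D psi <= D beta / h, |D P_c| <= max P_c' h and min b h <= D beta. *)
Lemma mobility_pressure (y z : R) : nondegenerate e y -> nondegenerate e z ->
  face_mobility P y z * (Pc P z - Pc P y) ^+ 2 <=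
  mobility_const * (beta P z - beta P y) ^+ 2.
Proof.
wlog yz : y z / y <= z => [H yr zr|yr zr].
  case: (leP y z) => [yz|/ltW zy]; first exact: H.
  by rewrite face_mobilityC -[in leLHS]sqrrN -[in leRHS]sqrrN !opprB; exact: H.
have e0 := e_gt0; have := yr; have := zr.
rewrite /nondegenerate => /andP[_ z1] /andP[y0 _].
rewrite /face_mobility; case: eqVneq => [->|zy].
  by rewrite !subrr expr0n/= !mulr0.
have {zy}yz : y < z by rewrite lt_neqAle eq_sym zy.
have /andP[b1 _] := beta_increment A3 e0 y0 (ltW yz) z1.
have /andP[p1 p2] := Pc_increment A3 A4 e0 y0 (ltW yz) z1.
have psi1 := psi_increment A3 e0 Dr y0 (ltW yz) z1.
have bm := b_min_gt0 P e0.
move: b1 p1 p2 psi1; set db := beta P z - _; set dp := Pc P z - _.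
set ds := psi P z - _; set h := z - y => b1 p1 p2 psi1.
have h0 : 0 < h by rewrite subr_gt0.
have db0 : 0 <= db by rewrite (le_trans _ b1)// mulr_ge0// ltW.
have dp2 : dp ^+ 2 <= dPc_max P e ^+ 2 * h ^+ 2.
  by rewrite -exprMn lerXn2r ?nnegrE// mulr_ge0 ?(ltW h0)// ltW// dPc_max_gt0.
apply: (@le_trans _ _ (db / h * (dPc_max P e ^+ 2 * h ^+ 2))).
  apply: ler_pM => //; [|exact: sqr_ge0|].
    by rewrite divr_ge0//; lra.
  by rewrite ler_wpM2l// lef_pV2 ?posrE//; lra.
have -> : db / h * (dPc_max P e ^+ 2 * h ^+ 2) = dPc_max P e ^+ 2 * db * h.
  by field; rewrite gt_eqF.
have -> : mobility_const * db ^+ 2 = dPc_max P e ^+ 2 * db * (db / b_min P e).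
  by rewrite /mobility_const; ring.
apply: ler_wpM2l; first by rewrite mulr_ge0// sqr_ge0.
by rewrite ler_pdivlMr// mulrC.
Qed.

Let w K := (beta P (x K) - beta P (x' K)) / dt.

(** Test with the rate [w]. As beta is increasing with slope at most max b, the
accumulation term dominates (max b)^-1 m Phi w^2. *)
Lemma rate_estimate :
  (b_max P e)^-1 * \sum_K cell_mass K * w K ^+ 2
  + 2^-1 * \sum_s conductance x (face_cell m s) s
             * face_jump P 0 w (face_cell m s) s ^+ 2
  <= 2^-1 * mobility_const * dirichlet_energy x.
Proof.
have e0 := e_gt0; have dt0 := dt_gt0.
have bM := b_max_gt0 P e0.
have h1 : (b_max P e)^-1 * \sum_K cell_mass K * w K ^+ 2 <=
    dt^-1 * \sum_K cell_mass K * (x K - x' K) * w K.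
  rewrite !mulr_sumr; apply: ler_sum => K _.
  rewrite -[X in _ <= _ * X]mulrA [leLHS]mulrCA [leRHS]mulrCA ler_pM2l//.
  rewrite ler_pdivrMl//.
  have -> : b_max P e * (dt^-1 * ((x K - x' K) * w K)) =
      (dt^-1 * (b_max P e * (x K - x' K))) * w K by ring.
  rewrite expr2.
  have /andP[x1 x2] := xr K; have /andP[x'1 x'2] := x'r K.
  case: (leP (x K) (x' K)) => [xx|/ltW xx].
    have /andP[h1 h2] := beta_increment A3 e0 x1 xx x'2.
    have h3 : beta P (x K) <= beta P (x' K).
      have : 0 <= b_min P e * (x' K - x K).
        by rewrite mulr_ge0 ?subr_ge0// ltW// b_min_gt0.
      lra.
    rewrite ler_wnM2r//.
      by rewrite /w pmulr_lle0 ?invr_gt0// subr_le0.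
    by rewrite /w mulrC ler_pM2r ?invr_gt0//; lra.
  have /andP[h1 h2] := beta_increment A3 e0 x'1 xx x2.
  have h3 : beta P (x' K) <= beta P (x K).
    have : 0 <= b_min P e * (x K - x' K).
      by rewrite mulr_ge0 ?subr_ge0// ltW// b_min_gt0.
    lra.
  rewrite ler_wpM2r//.
    by rewrite /w divr_ge0 ?subr_ge0// ltW.
  by rewrite /w [leRHS]mulrC ler_pM2r ?invr_gt0//; lra.
have h2 : - \sum_s conductance x (face_cell m s) s *
      face_jump P (Pc P sD)
        (fun L => Pc P (x L) + (beta P (x L) - beta P (x' L)) / dt)
        (face_cell m s) s * face_jump P 0 w (face_cell m s) s
    <= 2^-1 * mobility_const * dirichlet_energy x -
      2^-1 * \sum_s conductance x (face_cell m s) s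
             * face_jump P 0 w (face_cell m s) s ^+ 2.
  rewrite /dirichlet_energy !mulr_sumr -sumrN -sumrB.
  apply: ler_sum => s _; set K := face_cell m s.
  rewrite pressure_jump -/w; set q := face_jump P 0 w K s.
  set p := face_jump P (Pc P sD) _ K s; set b := face_jump P _ _ K s.
  set y := face_value P sD x K s.
  have yr : nondegenerate e y.
    exact: (@face_value_ind _ _ _ P m R (nondegenerate e) sD x K s).
  have pE : p = Pc P y - Pc P (x K) by rewrite /p /face_jump face_value_map.
  have bE : b = beta P y - beta P (x K) by rewrite /b /face_jump face_value_map.
  have := mobility_pressure (xr K) yr; rewrite -pE -bE.
  move=> /(ler_wpM2l (transmissibility_ge0 s)).
  rewrite mulrA -/(conductance x K s).
  have := conductance_ge0 K s x01.
  set c := conductance x K s; set t := transmissibility s => c0 h.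
  have : 0 <= c * (p + q) ^+ 2 by rewrite mulr_ge0// sqr_ge0.
  lra.
have := h1; rewrite test_step mulrN mulKf ?gt_eqF//; lra.
Qed.

End step.
End scalar_scheme.

(** * The scheme as an equation for the total saturation *)

Section cells.
Context (R : realType) (d n : nat) (P : problem R d n).
Hypothesis OmegaP : domain_ok P.

Section mesh_cells.
Context (m : mesh R d).
Hypothesis adm : admissible P m.
Implicit Types K : cell m.

Lemma cell_sub K : (cell_set m K `<=` Omega P)%classic.
Proof. by case: adm => -[/(_ K)[_ +] _] _ _ _. Qed.

Lemma cell_open K : open (cell_set m K).
Proof. by case: adm => -[/(_ K)[+ _] _] _ _ _; exact: open_open_polytope. Qed.

Lemma cell_volume_gt0 K : (0 < volume (cell_set m K))%E.
Proof.
apply: volume_gt0; first exact: cell_open.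
by case: adm => -[/(_ K)[[+ _] _] _] _ _ _.
Qed.

Lemma cell_volume_lty K : (volume (cell_set m K) < +oo)%E.
Proof.
case: OmegaP => -[_ _ _ [r Or]] _ _ _ _.
by apply: (@volume_lt_pinfty _ _ _ r (@cell_open K)) => x /cell_sub/Or.
Qed.

Lemma cell_measure_gt0 K : 0 < cell_measure K.
Proof. by rewrite fine_gt0// cell_volume_gt0 cell_volume_lty. Qed.

Lemma vmeasurable_cell K f : vmeasurable (Omega P) f ->
  vmeasurable (cell_set m K) f.
Proof.
case: OmegaP => -[oO _ _ _] _ _ _ _; apply: measurable_funS.
  exact: measurable_open.
by move=> t; exact: cell_sub.
Qed.

End mesh_cells.

Hypothesis A1 : assumption_A1 P.

Lemma cell_mass_lower : exists2 c : R, 0 < c &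
  forall m : mesh R d, admissible P m ->
    forall K : cell m, c * cell_measure K <= cell_mass P K.
Proof.
case: A1 => -[iPhi Phi01] [c c0 cPhi] _ _ _; exists c => // m adm K.
rewrite /cell_mass mulrC ler_pM2l ?cell_measure_gt0//.
suff /andP[] : c <= cell_mean (cell_set m K) (Phi P) <= 1 by [].
apply: cell_mean_bounds; [exact: cell_open|exact: cell_volume_gt0|
  exact: cell_volume_lty| |].
  apply: vmeasurable_cell => //; apply/measurable_EFinP.
  exact: measurable_int iPhi.
move=> x /(cell_sub adm) Ox; rewrite cPhi//.
by have /andP[] := Phi01 x Ox.
Qed.

(** Cell means inherit the pointwise bounds on the initial data, uniformly in the
mesh. *)
Lemma initial_lower : exists2 c : R, 0 < c &
  forall m : mesh R d, admissible P m -> forall K : cell m,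
  let S := \row_(i < n) cell_mean (cell_set m K) (fun x => S0 P x ord0 i) in
  (forall i, c <= S ord0 i) /\ tot_sat S <= 1 - c.
Proof.
case: A1 => _ _ mS0 _ [c c01 cS0].
have /andP[c0 c1] := c01.
exists c => // m adm K S.
have mSK i := vmeasurable_cell adm (K:=K) (mS0 i).
have S0b i x : cell_set m K x -> c <= S0 P x ord0 i <= 1.
  move=> /(cell_sub adm)/cS0[cS S1]; rewrite cS/=.
  rewrite (le_trans _ (_ : 1 - c <= 1)) ?gerBl ?(ltW c0)//.
  rewrite (le_trans _ S1)// /tot_sat (bigD1 i)//= lerDl sumr_ge0// => j _.
  by rewrite (le_trans (ltW c0)).
have mean := @cell_mean_bounds R d _ (cell_open adm (K:=K))
  (cell_volume_gt0 adm K) (cell_volume_lty adm K).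
split=> [i|]; first by rewrite mxE; have /andP[] := mean _ c 1 (mSK i) (S0b i).
rewrite /tot_sat; under eq_bigr do rewrite mxE.
rewrite cell_mean_sum; [|exact: cell_open|]; last first.
  move=> i; apply: (vintegrable_bounded _ _ (mSK i) (S0b i)).
    exact: cell_open.
  exact: cell_volume_lty.
suff /(mean _ 0 (1 - c)) H : vmeasurable (cell_set m K)
    (fun x => \sum_(i < n) S0 P x ord0 i).
  have /andP[] // : 0 <= cell_mean (cell_set m K)
      (fun x => \sum_(i < n) S0 P x ord0 i) <= 1 - c.
  apply: H => x Kx; have [cS ->] := cS0 x (cell_sub adm Kx); rewrite andbT.
  by rewrite sumr_ge0// => i _; rewrite (le_trans (ltW c0)).
by rewrite /vmeasurable; apply: measurable_sum => i; exact: mSK.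
Qed.

End cells.

Section scheme.
Context (R : realType) (d n : nat) (P : problem R d n) (m : mesh R d).
Hypotheses (n_gt0 : (0 < n)%N) (SDP : saturation_set (SD P))
  (A2 : assumption_A2 P).

(** [assumption_A2] applies at the face average, which lies in the convex set of
admissible saturations. *)
Lemma coef_M_colsum0 (S T : 'rV[R]_n) (j : 'I_n) :
  saturation_set S -> saturation_set T ->
  \sum_(i < n) coef_M P (2^-1 *: (S + T)) i j = 0.
Proof.
move=> [S0 S1] [T0 T1]; set U := 2^-1 *: _.
have US : saturation_set U.
  split; first by move=> i; rewrite !mxE mulr_gt0 ?invr_gt0// addr_gt0.
  under eq_bigr do rewrite !mxE; rewrite -mulr_sumr big_split/=; lra.
have Uc i : 0 <= U ord0 i <= 1.
  case: US => U0 /ltW U1; rewrite ltW//= (le_trans _ U1)//.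
  by rewrite (bigD1 i)//= lerDl sumr_ge0// => k _; exact: ltW.
case: A2 => _ Msym Mpos [c [C [_ _ MC]]].
apply: (@quad_colsum0 _ _ _ C); first exact: Msym.
by move=> z; rewrite Mpos//=; have /andP[] := MC U z US.
Qed.

Lemma sum_flux (dt : R) (S S' mu : cell m -> 'rV[R]_n) K s :
  (forall L, saturation_set (S L)) ->
  \sum_(i < n) flux P dt S S' mu i K s =
  - (conductance P (fun L => tot_sat (S L)) K s *
     face_jump P (Pc P (tot_sat (SD P)))
       (fun L => Pc P (tot_sat (S L)) +
          (beta P (tot_sat (S L)) - beta P (tot_sat (S' L))) / dt) K s).
Proof.
move=> Ssat; rewrite /flux.
set T := face_value P (SD P) S K s.
have Tsat : saturation_set T.
  exact: (@face_value_ind _ _ _ P m _ (@saturation_set R n) (SD P) S K s).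
rewrite {1}/beta_rate subrr mul0r addr0 big_split/= sumrN.
rewrite [X in _ - X](_ : _ = 0) ?subr0; last first.
  rewrite -mulr_sumr exchange_big/= big1 ?mulr0// => j _.
  by rewrite -mulr_suml coef_M_colsum0 ?mul0r.
rewrite -!mulr_suml -mulr_sumr sum_face_fraction ?sum_composition//.
- rewrite /conductance face_value_map -/T mulr1 !mulNr; congr (- (_ * _)).
- by move=> i; exact: composition_gt0.
- by move=> i; exact: composition_gt0.
Qed.

Lemma scheme_scalar_step (N : nat) (mu S : nat -> cell m -> 'rV[R]_n) :
  0 < Tend P -> (0 < N)%N -> scheme_solution P N mu S ->
  forall k, (0 < k <= N)%N ->
  scalar_step P (Tend P / N%:R)
    (fun K => tot_sat (S k K)) (fun K => tot_sat (S k.-1 K)).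
Proof.
move=> T0 N0 [_ Ssat eqn] k kN K.
set dt := Tend P / N%:R.
have dt0 : 0 < dt by rewrite divr_gt0// ltr0n.
have : \sum_(i < n) (cell_measure K / dt * cell_mean (cell_set m K) (Phi P)
           * (S k K ord0 i - S k.-1 K ord0 i)
         + \sum_(s in faces m K) flux P dt (S k) (S k.-1) (mu k) i K s) = 0.
  by apply: big1 => i _; exact: eqn.
rewrite big_split/= -mulr_sumr sumrB exchange_big/=.
under [X in _ + X]eq_bigr => s _.
  rewrite sum_flux; first over.
  by move=> L; case: (Ssat k L kN).
rewrite sumrN => /eqP; rewrite subr_eq0 => /eqP <-.
rewrite /cell_mass -!/(tot_sat _); field; rewrite gt_eqF//.
Qed.

(** The rest of the energy density is the relative entropy of the
composition. *)
Lemma Psi_le_energy (S : 'rV[R]_n) :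
  (forall i, 0 < S ord0 i) ->
  Psi P (tot_sat S) <= energy_density P S.
Proof.
move=> S0; rewrite /energy_density lerDr.
have Sp : 0 < tot_sat S.
  rewrite /tot_sat (bigD1 (Ordinal n_gt0))//= ltr_pwDl// sumr_ge0// => i _.
  exact: ltW.
apply: entropy_ge0 => //; last exact: tot_sat_gt0.
by case: SDP.
Qed.

End scheme.

Theorem proposition6 (R : realType) (d n : nat) (P : problem R d n)
  (d_gt0 : (0 < d)%N) (n_gt0 : (0 < n)%N)
  (OmegaP : domain_ok P) (Tend_gt0 : 0 < Tend P)
  (SDP : saturation_set (SD P))
  (A1 : assumption_A1 P) (A2 : assumption_A2 P)
  (A3 : assumption_A3 P) (A4 : assumption_A4 P) :
  exists C : R -> R,
    (forall h : R, 0 < C h) /\ {homo C : x y / x <= y} /\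
    forall (m : mesh R d) (N : nat) (mu S : nat -> cell m -> 'rV[R]_n),
      admissible P m -> (0 < N)%N -> scheme_solution P N mu S ->
      forall k : nat, (0 < k <= N)%N ->
        let w : cell m -> R :=
          fun K => beta_rate P (Tend P / N%:R) (S k K) (S k.-1 K) in
        \sum_(K : cell m) cell_measure K * `|w K| ^+ 2
        + \sum_(s : face m)
            transmissibility s
            * face_mobility P (tot_sat (S k (face_cell m s)))
                (tot_sat (face_value P (SD P) (S k) (face_cell m s) s))
            * `|face_jump P (beta_rate P (Tend P / N%:R) (SD P) (SD P))
                  w (face_cell m s) s| ^+ 2
        <= C (discrete_energy P (S 0%N)).
Proof.
have [cPhi cPhi0 massP] := cell_mass_lower OmegaP A1.
have [c0 c0_gt0 initP] := initial_lower OmegaP A1.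
set sD := tot_sat (SD P).
have sD0 : 0 < sD by exact: tot_sat_gt0.
have sD1 : sD < 1 by case: SDP.
have sD01 : 0 < sD < 1 by rewrite sD0.
pose e := Num.min c0 (Num.min sD (1 - sD)).
have e0 : 0 < e by rewrite !lt_min c0_gt0 sD0 subr_gt0.
have ec : e <= c0 by rewrite ge_min lexx.
have Dr : nondegenerate e sD.
  have h1 : e <= sD by rewrite !ge_min lexx orbT.
  have h2 : e <= 1 - sD by rewrite !ge_min lexx !orbT.
  by rewrite /nondegenerate; lra.
(* with h the discrete energy, (max b)^-1 V + W / 2 <= mobility_const * h bounds
   the sum U + W that is to be estimated, where cPhi U <= V *)
pose B := mobility_const P e * (2 + b_max P e / cPhi).
have bM := b_max_gt0 P e0; have bm := b_min_gt0 P e0.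
have mc : 0 < mobility_const P e.
  by rewrite divr_gt0// exprn_gt0// dPc_max_gt0.
have B0 : 0 < B by rewrite mulr_gt0// addr_gt0// divr_gt0.
exists (fun h => B * Num.max h 0 + 1); split.
  by move=> h; rewrite ltr_wpDl// mulr_ge0 ?(ltW B0)// le_max lexx orbT.
split.
  move=> x y xy; rewrite lerD2r ler_pM2l//.
  by rewrite ge_max !le_max xy/= lexx orbT.
move=> m N mu S adm N0 sol k kN /=.
set dt := Tend P / N%:R.
have dt0 : 0 < dt by rewrite divr_gt0// ltr0n.
have cm0 K : 0 < cell_measure (m := m) K.
  exact: (cell_measure_gt0 OmegaP adm).
have mass0 K : 0 < cell_mass P (m := m) K.
  by rewrite (lt_le_trans _ (massP _ adm K))// mulr_gt0.
pose x j K := tot_sat (S j K).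
have steps j : (0 < j <= N)%N -> scalar_step P dt (x j) (x j.-1).
  by move=> jN; exact: (scheme_scalar_step n_gt0 SDP A2 Tend_gt0 N0 sol).
case: (sol) => S0E Ssat _.
have x01 j K : (0 < j <= N)%N -> 0 < x j K < 1.
  by move=> jN; have [sat _] := Ssat j K jN; rewrite tot_sat_gt0//=; case: sat.
have initK K : (forall i, c0 <= S 0%N K ord0 i) /\ tot_sat (S 0%N K) <= 1 - c0.
  by rewrite S0E; exact: initP.
have x0r K : nondegenerate e (x 0%N K).
  have [lo up] := initK K; apply/andP; split; last first.
    by rewrite (le_trans up)// lerD2l lerN2.
  rewrite (le_trans ec)// /x /tot_sat (bigD1 (Ordinal n_gt0))//=.
  rewrite (le_trans (lo (Ordinal n_gt0)))// lerDl sumr_ge0// => i _.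
  by rewrite (le_trans (ltW c0_gt0)).
have main j : (j <= N)%N -> (forall K, nondegenerate e (x j K)) /\
    scalar_energy P (x j) <= scalar_energy P (x 0%N).
  elim: j => [|j IH] jN; first by split.
  have [IHr IHe] := IH (ltnW jN).
  have xj01 K : 0 < x j.+1 K < 1 by exact: x01.
  have xj'01 K : 0 < x j K < 1 by exact: (nondegenerate01 e0).
  have st : scalar_step P dt (x j.+1) (x j) by exact: (steps j.+1).
  have xr := step_nondegenerate A3 A4 sD01 dt0 st xj01 xj'01 mass0 e0 Dr IHr.
  split => //; apply: le_trans IHe.
  exact: (scalar_energy_decreases A3 A4 adm sD01 dt0 st xj01 mass0 e0 Dr).
have [xr ekP] := main k (andP kN).2.
have [xr' _] := main k.-1 (leq_trans (leq_pred k) (andP kN).2).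
have est := rate_estimate A3 A4 adm sD01 dt0 (steps k kN)
  (fun K => x01 k K kN) mass0 e0 Dr xr xr'.
pose h := discrete_energy P (S 0%N).
have eh : scalar_energy P (x 0%N) <= h.
  rewrite /scalar_energy /h /discrete_energy /dirichlet_energy; apply: lerD.
    apply: ler_sum => K _; rewrite mulrA ler_pM2l//.
    apply: (Psi_le_energy n_gt0 SDP) => i.
    by rewrite (lt_le_trans c0_gt0)//; case: (initK K).
  rewrite ler_pM2l ?invr_gt0//; apply: ler_sum => s _.
  by rewrite real_normK ?num_real.
have psi0 : 0 <= \sum_K cell_mass P K * Psi P (x k K).
  apply: sumr_ge0 => K _; rewrite mulr_ge0 ?(ltW (mass0 K))//.
  exact: (Psi_ge0 A3 e0 Dr).
have dir : 2^-1 * dirichlet_energy P (x k) <= h.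
  by have := le_trans ekP eh; rewrite /scalar_energy; lra.
have dir0 : 0 <= dirichlet_energy P (x k).
  by apply: sumr_ge0 => s _; rewrite mulr_ge0 ?transmissibility_ge0 ?sqr_ge0.
pose w' K := (beta P (x k K) - beta P (x k.-1 K)) / dt.
have -> : \sum_(K : cell m) cell_measure K
      * `|beta_rate P dt (S k K) (S k.-1 K)| ^+ 2 =
    \sum_K cell_measure K * w' K ^+ 2.
  by apply: eq_bigr => K _; rewrite real_normK ?num_real.
rewrite [X in _ + X <= _](_ : _ = \sum_s conductance P (x k) (face_cell m s) s
    * face_jump P 0 w' (face_cell m s) s ^+ 2); last first.
  apply: eq_bigr => s _; rewrite real_normK ?num_real//.
  by rewrite /beta_rate subrr mul0r /conductance face_value_map.
have : cPhi * \sum_K cell_measure K * w' K ^+ 2 <=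
    \sum_K cell_mass P K * w' K ^+ 2.
  rewrite mulr_sumr; apply: ler_sum => K _.
  by rewrite mulrA ler_wpM2r ?sqr_ge0// massP.
have c2 : 0 <= \sum_s conductance P (x k) (face_cell m s) s
    * face_jump P 0 w' (face_cell m s) s ^+ 2.
  apply: sumr_ge0 => s _; rewrite mulr_ge0 ?sqr_ge0//.
  by apply: (conductance_ge0 A3 sD01) => K; exact: x01.
have hm : h <= Num.max h 0 by rewrite le_max lexx.
move: est c2.
set W := \sum_s conductance P (x k) (face_cell m s) s
    * face_jump P 0 w' (face_cell m s) s ^+ 2.
set V := \sum_K cell_mass P K * w' K ^+ 2.
set U := \sum_K cell_measure K * w' K ^+ 2 => est c2 UV.
have U0 : 0 <= U.
  by apply: sumr_ge0 => K _; rewrite mulr_ge0 ?sqr_ge0 ?(ltW (cm0 K)).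
have V0 : 0 <= V by apply: le_trans UV; rewrite mulr_ge0// ltW.
have estM : (b_max P e)^-1 * V + 2^-1 * W <= mobility_const P e * Num.max h 0.
  apply: (le_trans est); rewrite [2^-1 * _]mulrC -mulrA ler_pM2l//.
  by rewrite (le_trans dir).
have hW : W <= 2 * (mobility_const P e * Num.max h 0).
  have : 0 <= (b_max P e)^-1 * V by rewrite mulr_ge0// invr_ge0 ltW.
  lra.
have hV : V <= b_max P e * (mobility_const P e * Num.max h 0).
  by rewrite -ler_pdivrMl//; lra.
have hU : U <= cPhi^-1 * (b_max P e * (mobility_const P e * Num.max h 0)).
  by rewrite ler_pdivlMl// (le_trans UV).
have -> : B * Num.max h 0 = 2 * (mobility_const P e * Num.max h 0) +
   cPhi^-1 * (b_max P e * (mobility_const P e * Num.max h 0)).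
  by rewrite /B; ring.
lra.
Qed.
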